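(* Let $r,R>0$ be real numbers and let $o\in\mathbb{R}^2$. Then for every large enough integer $N$ the following holds. Let $\{a_i\}_{i=1}^\infty$ be a sequence of points of the circumference $\partial B_R(o)\subset\mathbb{R}^2$ such that $N\cdot|a_1a_2|=r$ and, for every $i\in\mathbb{N}$, $|a_{i+1}a_{i+2}|=\tfrac12|a_ia_{i+1}|$ and $\angle a_ia_{i+1}a_{i+2}>\pi/2$. Let $a_\infty$ be the limit point of $\{a_i\}$, and let $a_{\infty+1}$ be the point of the tangent line to $B_R(o)$ at $a_\infty$ such that $|a_\infty a_{\infty+1}|=r/N$, lying on the tangent line on the side in which the sequence $a_i$ proceeds (i.e. $\langle a_{\infty+1}-a_\infty,\,a_\infty-a_i\rangle>0$ for all $i\in\mathbb{N}$). Put $$\Sigma=\Big(\bigcup_{i=1}^\infty[a_ia_{i+1}]\Big)\cup[a_\infty a_{\infty+1}].$$ Let $v_1$ be the point of the ray starting at $a_2$ and passing through $a_1$ such that $|v_1a_1|=r$. For $i\in\mathbb{N}\setminus\{1\}$ let $v_i\in\mathbb{R}^2$ be the point satisfying $|v_ia_i|=r$ and $\angle a_{i-1}a_iv_i=\angle a_{i+1}a_iv_i>\pi/2$. Let $v_\infty$ be the limit point of $\{v_i\}$. Let $v_{\infty+1}$ be the point of the ray starting at $a_\infty$ and passing through $a_{\infty+1}$, lying beyond $a_{\infty+1}$, such that $|v_{\infty+1}a_{\infty+1}|=r$ (so that $v_{\infty+1}a_\infty\perp v_\infty a_\infty$). Put $M=\{v_i: i\in\mathbb{N}\}\cup\{v_\infty,v_{\infty+1}\}$,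 which is a compact set. Then $\Sigma$ is the unique $r$-minimizer for $M$.
   Context: $\mathcal{H}^1$ is the one-dimensional Hausdorff measure; $B_R(o)$ is the open disc of radius $R$ centred at $o$; $[xy]$ is the closed segment with endpoints $x,y$ and $|xy|$ its length. For a compact set $M\subset\mathbb{R}^2$ and $r>0$, an $r$-minimizer for $M$ (maximal distance minimizer) is a connected compact set $\Sigma\subset\mathbb{R}^2$ that has the minimal length $\mathcal{H}^1(\Sigma)$ among all connected compact sets satisfying $\max_{y\in M}\operatorname{dist}(y,\Sigma)\le r$. *)

(* Defs.v *)
From mathcomp Require Import all_boot all_order all_algebra.
From mathcomp Require Import all_classical all_reals all_analysis.
Import Order.TTheory GRing.Theory Num.Theory.
Import numFieldNormedType.Exports.

Set Implicit Arguments.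
Unset Strict Implicit.
Unset Printing Implicit Defensive.

Local Open Scope classical_set_scope.
Local Open Scope ring_scope.

(** The plane is ['rV[K]_2].  The library norm on row vectors is the sup norm:
    it induces the usual topology (hence [compact], [connected] and limits are
    the library's), but all metric notions below use the Euclidean norm. *)
Section EuclideanPlane.
Context {K : realType}.
Implicit Types (o p q x y u w : 'rV[K]_2) (A M S : set 'rV[K]_2) (r : K).

Definition dot u w : K := \sum_(i < 2) u 0 i * w 0 i.

Definition enorm u : K := Num.sqrt (dot u u).

Definition edistance x y : K := enorm (x - y).

(** The unsigned angle at the vertex [q], in [[0, pi]]. *)
Definition angle p q x : K :=
  acos (dot (p - q) (x - q) / (edistance p q * edistance x q)).

Definition segment x y : set 'rV[K]_2 :=
  [set (1 - t) *: x + t *: y | t in [set t : K | 0 <= t <= 1]].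

Definition ray x y : set 'rV[K]_2 :=
  [set x + t *: (y - x) | t in [set t : K | 0 <= t]].

Definition circle o r : set 'rV[K]_2 := [set x | edistance x o = r].

(** The tangent line at [p] to the disc centred at [o] whose boundary
    contains [p]. *)
Definition tangent_line o p : set 'rV[K]_2 :=
  [set x | dot (x - p) (p - o) = 0].

Local Open Scope ereal_scope.

(** The value 0 is added so that the empty set has diameter 0, not -oo. *)
Definition diameter A : \bar K :=
  ereal_sup (0 |` [set (edistance z.1 z.2)%:E | z in A `*` A]).

Definition hausdorff1_pre (delta : K) A : \bar K :=
  ereal_inf [set \sum_(0 <= i <oo) diameter (U i) | U in
    [set U : (set 'rV[K]_2)^nat |
      A `<=` \bigcup_i U i /\ forall i, diameter (U i) <= delta%:E]].

(** One-dimensional Hausdorff measure, normalized so that the measure of a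
    segment is its length. *)
Definition hausdorff1 A : \bar K :=
  ereal_sup [set hausdorff1_pre delta A | delta in [set d : K | (0 < d)%R]].

(** Equal to +oo when [S] is empty, so that the empty set, which is
    [connected] for the library, never covers a nonempty [M]. *)
Definition dist_to_set y S : \bar K :=
  ereal_inf [set (edistance y x)%:E | x in S].

Definition covers r M S : Prop :=
  ereal_sup [set dist_to_set y S | y in M] <= r%:E.

Definition admissible r M S : Prop :=
  [/\ connected S, compact S & covers r M S].

Definition r_minimizer r M S : Prop :=
  admissible r M S /\
  forall S', admissible r M S' -> hausdorff1 S <= hausdorff1 S'.

End EuclideanPlane.

(* Main.v *)
Require Import Defs.
From mathcomp Require Import all_boot all_order all_algebra.
From mathcomp Require Import all_classical all_reals all_analysis.
From mathcomp Require Import ring lra.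
Import Order.TTheory GRing.Theory Num.Theory.
Import numFieldNormedType.Exports.

(** Let [u i] be the unit direction of the edge from [a i] to [a i.+1]. The
    polygonal line Sigma is a critical point of the length: at [a i.+1] the
    kink [u i - u i.+1] is a positive multiple of [v i.+1 - a i.+1], and at
    both ends Sigma leaves the balls around the [v]'s along a normal. The proof
    turns this into a certificate of global minimality by the duality of the
    Steiner problem. Put the weight [- u 0] at a point [x] of the first ball,
    [kink u i] at a point of the ball around [v i.+1], and [u n] at a point of
    the last ball. If every partial sum of weights along a network has norm at
    most 1, then the length of the network is at least the weighted sum of its
    terminals ([dual_value]). The balls lie in half-planes bounded by lines
    through the vertices of Sigma and normal to the weights, so this sum is
    smallest at the vertices, where it tends to the length of Sigma.

    The partial sums have norm at most 1 as soon as the directions are unit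
    vectors and the kinks have nonnegative inner products ([flux_unit]). That
    holds when [N] is large: the kinks then all point almost radially away from
    [o], at almost the same place of the circle ([spiral_kink_dot]).

    A connected set need not be a tree. However, any fine cover of it by small
    sets contains a simple chain joining two given points, together with a
    simple chain from a third point to the first chain, disjoint from it
    ([path_in_finite_cover]). So up to an arbitrarily small error the length
    pays for a path from the first to the last ball and for the distance from
    that path to the farthest point of the set. Since the kinks have total norm
    at most [1/2], moving all the other terminals onto the path costs at most
    half of that distance ([almost_optimal_path]). This gives the lower bound
    for all competitors at once ([chain_lower_bound]).

    If a competitor has the length of Sigma, then all inequalities are
    equalities and it contains every vertex, because a closed ball meets its
    tangent lines in one point only ([ball_halfplane]). Moreover its
    almost optimal paths cannot move backwards, as the partial sums of weights
    stay within [1/2] of [u 0]; they visit the vertices in order, so every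
    other point of the competitor is visited between two consecutive vertices
    and is close to the segment between them ([between_vertices]). Hence the
    competitor lies in Sigma. It is all of Sigma because it is connected and
    the linear form [dot (u 0)] is injective on Sigma. *)

Set Implicit Arguments.
Unset Strict Implicit.
Unset Printing Implicit Defensive.

Local Open Scope classical_set_scope.
Local Open Scope ring_scope.

(** * The Euclidean plane *)

Section Euclid.
Context {K : realType}.
Implicit Types (p q x y z u w : 'rV[K]_2) (c t : K).

Lemma dotE u w : dot u w = u 0 0 * w 0 0 + u 0 1 * w 0 1.
Proof.
rewrite /dot big_ord_recl big_ord1; congr (_ + u 0 _ * w 0 _); exact/val_inj.
Qed.

Lemma dotC u w : dot u w = dot w u.
Proof. by rewrite !dotE; ring. Qed.

Lemma dotDl x u w : dot (u + w) x = dot u x + dot w x.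
Proof. by rewrite !dotE !mxE; ring. Qed.

Lemma dotDr x u w : dot x (u + w) = dot x u + dot x w.
Proof. by rewrite !dotE !mxE; ring. Qed.

Lemma dotNl u w : dot (- u) w = - dot u w.
Proof. by rewrite !dotE !mxE; ring. Qed.

Lemma dotNr u w : dot u (- w) = - dot u w.
Proof. by rewrite !dotE !mxE; ring. Qed.

Lemma dotZl c u w : dot (c *: u) w = c * dot u w.
Proof. by rewrite !dotE !mxE; ring. Qed.

Lemma dotZr c u w : dot u (c *: w) = c * dot u w.
Proof. by rewrite !dotE !mxE; ring. Qed.

Lemma dot0l u : dot 0 u = 0.
Proof. by rewrite !dotE !mxE; ring. Qed.

Lemma dot0r u : dot u 0 = 0.
Proof. by rewrite !dotE !mxE; ring. Qed.

Definition dot_lin := (dotDl, dotDr, dotNl, dotNr, dotZl, dotZr, dot0l, dot0r).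

Lemma dot_sumr (I : Type) (s : seq I) (P : pred I) (F : I -> 'rV[K]_2) u :
  dot u (\sum_(i <- s | P i) F i) = \sum_(i <- s | P i) dot u (F i).
Proof.
elim/big_ind2 : _ => [|x1 x2 y1 y2 <- <-|//]; first exact: dot0r.
exact: dotDr.
Qed.

Lemma dot_ge0 u : 0 <= dot u u.
Proof. by rewrite dotE -!expr2 addr_ge0 ?sqr_ge0. Qed.

Lemma dot_eq0 u : dot u u = 0 -> u = 0.
Proof.
rewrite dotE -!expr2 => /eqP; rewrite paddr_eq0 ?sqr_ge0// !sqrf_eq0.
move=> /andP[/eqP u0 /eqP u1]; apply/rowP => i; rewrite mxE.
case: i => -[|[|//]] ilt; [rewrite -[RHS]u0|rewrite -[RHS]u1];
  congr (u _ _); exact/val_inj.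
Qed.

Lemma enorm_ge0 u : 0 <= enorm u.
Proof. exact: sqrtr_ge0. Qed.

Lemma enorm_sqr u : enorm u ^+ 2 = dot u u.
Proof. by rewrite sqr_sqrtr// dot_ge0. Qed.

Lemma le_enorm u c : 0 <= c -> (enorm u <= c) = (dot u u <= c ^+ 2).
Proof. by move=> c0; rewrite -enorm_sqr ler_pXn2r// nnegrE enorm_ge0. Qed.

Lemma enorm_eq u c : 0 <= c -> dot u u = c ^+ 2 -> enorm u = c.
Proof. by move=> c0 e; rewrite /enorm e sqrtr_sqr ger0_norm. Qed.

Lemma enorm0 : enorm (0 : 'rV[K]_2) = 0.
Proof. by rewrite /enorm dot0l sqrtr0. Qed.

Lemma enorm0_eq0 u : enorm u = 0 -> u = 0.
Proof. by move=> u0; apply: dot_eq0; rewrite -enorm_sqr u0 expr0n. Qed.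

Lemma enormN u : enorm (- u) = enorm u.
Proof. by rewrite /enorm dotNl dotNr opprK. Qed.

Lemma enormZ c u : enorm (c *: u) = `|c| * enorm u.
Proof.
apply: enorm_eq; first by rewrite mulr_ge0 ?enorm_ge0.
by rewrite dotZl dotZr exprMn enorm_sqr real_normK ?num_real; ring.
Qed.

Lemma dot_sqr_le u w : dot u w ^+ 2 <= dot u u * dot w w.
Proof.
rewrite !dotE -subr_ge0.
set e := (X in 0 <= X).
have -> : e = (u 0 0 * w 0 1 - u 0 1 * w 0 0) ^+ 2 by rewrite /e; ring.
exact: sqr_ge0.
Qed.

Lemma dot_le u w : dot u w <= enorm u * enorm w.
Proof.
apply: le_trans (ler_norm _) _.
rewrite -(@ler_pXn2r _ 2) ?nnegrE ?mulr_ge0 ?enorm_ge0//.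
by rewrite real_normK ?num_real// exprMn !enorm_sqr dot_sqr_le.
Qed.

Lemma dot_geN u w : - (enorm u * enorm w) <= dot u w.
Proof. by rewrite lerNl -dotNl -(enormN u) dot_le. Qed.

Lemma enormD u w : enorm (u + w) <= enorm u + enorm w.
Proof.
rewrite le_enorm ?addr_ge0 ?enorm_ge0// dotDl !dotDr (dotC w u).
rewrite sqrrD !enorm_sqr; have := dot_le u w; lra.
Qed.

Lemma enormB u w : enorm (u - w) <= enorm u + enorm w.
Proof. by rewrite -(enormN w) enormD. Qed.

Lemma enorm_sum (I : Type) (s : seq I) (P : pred I) (F : I -> 'rV[K]_2) :
  enorm (\sum_(i <- s | P i) F i) <= \sum_(i <- s | P i) enorm (F i).
Proof.
elim/big_ind2 : _ => [|x1 x2 y1 y2 h1 h2|//]; first by rewrite enorm0.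
by apply: le_trans (enormD _ _) _; exact: lerD.
Qed.

Lemma edistance_ge0 x y : 0 <= edistance x y.
Proof. exact: enorm_ge0. Qed.

Lemma edistancexx x : edistance x x = 0.
Proof. by rewrite /edistance subrr enorm0. Qed.

Lemma edistance_eq0 x y : edistance x y = 0 -> x = y.
Proof. by move=> /enorm0_eq0/eqP; rewrite subr_eq0 => /eqP. Qed.

Lemma edistanceC x y : edistance x y = edistance y x.
Proof. by rewrite /edistance -enormN opprB. Qed.

Lemma edistance_triangle y x z :
  edistance x z <= edistance x y + edistance y z.
Proof. by rewrite /edistance -(subrK y x) -[_ - z]addrA (addrK _) enormD. Qed.

Lemma orthogonal_parallel e u w : dot e e != 0 -> dot w w != 0 ->
  dot e u = 0 -> dot e w = 0 -> u = (dot u w / dot w w) *: w.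
Proof.
move=> e0 w0 eu ew; apply/eqP; rewrite -subr_eq0; apply/eqP.
set d := _ - _.
have dw : dot d w = 0 by rewrite /d !dot_lin divfK// subrr.
have ed : dot e d = 0 by rewrite /d !dot_lin eu ew; ring.
apply: dot_eq0; move: dw ed e0 w0 ew; clearbody d; rewrite !dotE => dw ed e0 w0 ew.
have h : (e 0 0 * e 0 0 + e 0 1 * e 0 1) * (d 0 0 * d 0 0 + d 0 1 * d 0 1)
   = (e 0 0 * d 0 1 - e 0 1 * d 0 0) ^+ 2.
  transitivity ((e 0 0 * d 0 0 + e 0 1 * d 0 1) ^+ 2
    + (e 0 0 * d 0 1 - e 0 1 * d 0 0) ^+ 2); first by ring.
  by rewrite ed; ring.
have h2 : (w 0 0 * w 0 0 + w 0 1 * w 0 1) * (e 0 0 * d 0 1 - e 0 1 * d 0 0) = 0.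
  transitivity ((e 0 0 * w 0 0 + e 0 1 * w 0 1) * (w 0 0 * d 0 1 - w 0 1 * d 0 0)
    + (d 0 0 * w 0 0 + d 0 1 * w 0 1) * (w 0 1 * e 0 0 - w 0 0 * e 0 1)).
    by ring.
  by rewrite dw ew; ring.
move/eqP: h2; rewrite mulf_eq0 (negbTE w0)/= => /eqP h2.
by move/eqP: h; rewrite h2 expr0n/= mulf_eq0 (negbTE e0)/= => /eqP.
Qed.

Lemma segment_left x y : segment x y x.
Proof. by exists 0; [rewrite /= lexx ler01|rewrite subr0 scale1r scale0r addr0]. Qed.

Lemma segment_right x y : segment x y y.
Proof. by exists 1; [rewrite /= lexx ler01|rewrite subrr scale1r scale0r add0r]. Qed.

Lemma segmentB x y t : (1 - t) *: x + t *: y = x + t *: (y - x).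
Proof. by apply/rowP => i; rewrite !mxE; ring. Qed.

Lemma segment_edistance x y z : segment x y z -> edistance z x <= edistance x y.
Proof.
move=> [t /andP[t0 t1] <-]; rewrite segmentB /edistance addrC addKr enormZ.
by rewrite ger0_norm// -enormN opprB ler_piMl ?enorm_ge0.
Qed.

Lemma dot_continuous u : continuous (fun x => dot u x).
Proof.
have h i : continuous (fun z : 'rV[K]_2 => u 0 i * z 0 i).
  by move=> x; apply: continuousM; [exact: cst_continuous|exact: coord_continuous].
rewrite (_ : (fun x => _) = fun x => u 0 0 * x 0 0 + u 0 1 * x 0 1).
  by move=> x; exact: (continuousD (h 0 x) (h 1 x)).
by apply/funext => z; rewrite dotE.
Qed.

Lemma edistance_continuous y : continuous (fun x => edistance x y).
Proof.
have h i : continuous (fun z : 'rV[K]_2 => z 0 i - y 0 i).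
  by move=> x; apply: continuousB; [exact: coord_continuous|exact: cst_continuous].
rewrite (_ : (fun x => _) = Num.sqrt \o
    fun x => (x 0 0 - y 0 0) * (x 0 0 - y 0 0) + (x 0 1 - y 0 1) * (x 0 1 - y 0 1)).
  move=> x; apply: continuous_comp; last exact: sqrt_continuous.
  by apply: (continuousD (continuousM (h 0 x) (h 0 x)) (continuousM (h 1 x) (h 1 x))).
by apply/funext => z; rewrite /edistance /enorm dotE !mxE.
Qed.

Lemma open_edistance_ball y c : open [set x | edistance x y < c].
Proof.
apply: (@open_comp _ _ (fun x => edistance x y) [set t | t < c]).
  by move=> x _; exact: edistance_continuous.
exact: open_lt.
Qed.

Lemma edistance_cvg (f : nat -> 'rV[K]_2) (l : 'rV[K]_2) y :
  f @ \oo --> l -> (fun n => edistance (f n) y) @ \oo --> edistance l y.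
Proof.
by move=> fl; apply: (@continuous_cvg _ _ _ _ _ _ (fun x => edistance x y)) => //; exact: edistance_continuous.
Qed.

Lemma edistance_cvg0 (f : nat -> 'rV[K]_2) (l : 'rV[K]_2) : f @ \oo --> l ->
  forall e, 0 < e -> exists n, forall i, (n <= i)%N -> edistance (f i) l <= e.
Proof.
move=> fl e e0; have := edistance_cvg (y := l) fl.
rewrite edistancexx => /cvgrPdist_le/(_ _ e0)[n _ h].
by exists n => i /h; rewrite sub0r normrN ger0_norm ?edistance_ge0.
Qed.

Lemma edistance_lim_le (f : nat -> 'rV[K]_2) (l : 'rV[K]_2) y c n : f @ \oo --> l ->
  (forall i, (n <= i)%N -> edistance (f i) y <= c) -> edistance l y <= c.
Proof.
move=> /(edistance_cvg (y := y)) fl h.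
by apply: (cvgr_to_le fl); exists n.
Qed.

(** The topology of the plane comes from the sup norm, which the Euclidean norm
    dominates. *)
Lemma nbhs_edistance y (A : set 'rV[K]_2) : nbhs y A ->
  exists2 e, 0 < e & forall x, edistance x y < e -> A x.
Proof.
move=> /nbhs_ballP[e /= e0 h]; exists e => // x xy; apply: h; split=> // i j.
have dx k : `|(x - y) 0 k| <= edistance x y.
  rewrite -(@ler_pXn2r _ 2) ?nnegrE ?enorm_ge0// enorm_sqr real_normK ?num_real//.
  rewrite dotE -!expr2; case: k => -[|[|//]] klt.
    rewrite (_ : Ordinal klt = 0); last exact/val_inj.
    by rewrite lerDl sqr_ge0.
  rewrite (_ : Ordinal klt = 1); last exact/val_inj.
  by rewrite lerDr sqr_ge0.
rewrite (ord1 i) -ball_normE/= -normrN opprB.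
by apply: le_lt_trans xy; have := dx j; rewrite !mxE.
Qed.
End Euclid.

(** * Paths in a connected set covered by small sets *)

Section Paths.
Context {K : realType}.
Implicit Types (x y z s : 'rV[K]_2) (S : set 'rV[K]_2).

Definition path_length (q : nat -> 'rV[K]_2) (m : nat) : K :=
  \sum_(0 <= k < m) edistance (q k) (q k.+1).

Section FiniteCover.
Variables (I : finType) (V : I -> set 'rV[K]_2) (d : I -> K) (S : set 'rV[K]_2).
Hypothesis Vd : forall i x y, V i x -> V i y -> edistance x y <= d i.
Hypothesis d_ge0 : forall i, 0 <= d i.

Definition meet_in (i j : I) : bool := `[< exists z, [/\ V i z, V j z & S z] >].

(** Consecutive points are chosen in the intersections of consecutive members
    of the chain, so each step is paid for by one member. *)
Lemma path_of_chain i0 p x y : path meet_in i0 p -> V i0 x -> V (last i0 p) y ->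
  exists q, [/\ q 0%N = x, q (size p).+1 = y,
    path_length q (size p).+1 <= \sum_(i <- i0 :: p) d i &
    forall i, i \in i0 :: p -> exists2 k, (k <= (size p).+1)%N & V i (q k)].
Proof.
elim: p i0 x => [|j p IH] i0 x /=.
  move=> _ Vx Vy; exists (fun k => if k is 0%N then x else y); split => //.
    by rewrite /path_length big_nat1 big_seq1 Vd.
  by move=> i; rewrite inE => /eqP ->; exists 0%N.
move=> /andP[/asboolP[z [Viz Vjz Sz]] jp] Vx Vy.
have [q [q0 qy ql qV]] := IH _ _ jp Vjz Vy.
exists (fun k => if k is k'.+1 then q k' else x); split => //.
  rewrite /path_length big_nat_recl// big_cons q0 lerD ?Vd//.
move=> i; rewrite inE => /predU1P[->|]; first by exists 0%N.
by move=> /qV[k kp Vq]; exists k.+1.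
Qed.

(** The chain is followed only until it first meets a member of [P], so none of
    the diameters of members of [P] is spent. *)
Lemma branch_to_chain (P : seq I) j p s : path meet_in j p -> last j p \in P ->
  V j s -> exists z i, [/\ i \in P, V i z &
    edistance s z <= \sum_(i <- j :: p | i \notin P) d i].
Proof.
elim: p j s => [|j' p IH] j s /=.
  by move=> _ jP Vs; exists s, j; split => //; rewrite edistancexx sumr_ge0.
move=> /andP[/asboolP[c [Vjc Vc Sc]] jp] lP Vs.
have [jP|jP] := boolP (j \in P).
  by exists s, j; split => //; rewrite edistancexx sumr_ge0.
have [z [i [iP Vz cz]]] := IH _ _ jp lP Vc.
exists z, i; split => //; rewrite big_cons jP.
by apply: le_trans (edistance_triangle c _ _) _; rewrite lerD ?Vd.
Qed.

Hypothesis V_open : forall i, open (V i).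
Hypothesis V_cover : forall x, S x -> exists i, V i x.
Hypothesis S_connected : connected S.

(** The union of the members that a chain from [V i] reaches and the union of
    the others are open, and they are disjoint inside [S]. *)
Lemma chain_connect i x y : S x -> V i x -> S y ->
  exists2 j, V j y & connect meet_in i j.
Proof.
move=> Sx Vx Sy.
pose A := \bigcup_(j in [set j | connect meet_in i j]) V j.
pose B := \bigcup_(j in [set j | ~~ connect meet_in i j]) V j.
have AS : S `&` A = S.
  apply: S_connected.
  - by exists x; split => //; exists i => //=.
  - by exists A => //; apply: bigcup_open => j _.
  - exists (~` B).
      by rewrite closedC; apply: bigcup_open => j _.
    apply/seteqP; split => z [Sz].
      move=> [j /= ij Vj]; split => // -[j' /= ij' Vj']; case/negP: ij'.
      apply: connect_trans ij _; apply: connect1; apply/asboolP.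
      by exists z.
    move=> Bz; split => //; have [j Vj] := V_cover Sz; exists j => //=.
    by apply/negPn/negP => ij; apply: Bz; exists j.
by move: Sy; rewrite -AS => -[_ [j ij Vj]]; exists j.
Qed.

(** The path follows a simple chain of the cover from [x] to [y], and [s] is
    joined to it by a simple chain that avoids the members already used, so
    the diameters of the cover pay for both; [delta] pays for the one member
    in which the two chains meet. *)
Lemma path_in_finite_cover x y (delta : K) : S x -> S y ->
  (forall i, d i <= delta) ->
  exists q m, [/\ q 0%N = x, q m = y &
    forall s, S s -> exists2 k, (k <= m)%N &
      path_length q m + edistance s (q k) <= \sum_i d i + delta].
Proof.
move=> Sx Sy ddelta.
have [i0 Vx] := V_cover Sx.
have [j Vy /connectP[p0 p0P]] := chain_connect Sx Vx Sy.
case/shortenP: p0P => p pP pU _ jE; subst j.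
have [q [q0 qm ql qV]] := path_of_chain pP Vx Vy.
exists q, (size p).+1; split => // s Ss.
have [j0 Vs] := V_cover Ss.
have [j Vjx cj] := chain_connect Ss Vs Sx.
have : connect meet_in j0 i0.
  apply: connect_trans cj _; apply: connect1; apply/asboolP; by exists x.
move=> /connectP[p1 p1P]; case/shortenP: p1P => p' p'P p'U _ i0E.
have lP : last j0 p' \in i0 :: p by rewrite -i0E mem_head.
have [z [i [iP Vz sz]]] := branch_to_chain p'P lP Vs.
have [k km Vk] := qV _ iP; exists k => //.
have h1 : \sum_(l <- i0 :: p) d l = \sum_(l in i0 :: p) d l by exact: big_uniq.
have h2 : \sum_(l <- j0 :: p' | l \notin i0 :: p) d l <=
    \sum_(l | l \notin i0 :: p) d l.
  rewrite -big_filter big_uniq ?filter_uniq// [leRHS](bigID (mem (j0 :: p'))).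
  rewrite -[leLHS]addr0 lerD ?sumr_ge0//.
  by under eq_bigl do rewrite mem_filter.
have h3 := edistance_triangle z s (q k).
have h4 := le_trans (Vd Vz Vk) (ddelta i).
rewrite (bigID (mem (i0 :: p)))/=; lra.
Qed.

End FiniteCover.
End Paths.

Section HausdorffLower.
Context {K : realType}.
Implicit Types (x y z s : 'rV[K]_2) (A S : set 'rV[K]_2).

Lemma diameter_ge0 A : (0 <= diameter A)%E.
Proof. by apply: ereal_sup_ubound; left. Qed.

Lemma edistance_le_diameter A x y : A x -> A y ->
  ((edistance x y)%:E <= diameter A)%E.
Proof. by move=> Ax Ay; apply: ereal_sup_ubound; right; exists (x, y). Qed.

Lemma diameter_le A (c : K) : 0 <= c ->
  (forall x y, A x -> A y -> edistance x y <= c) -> (diameter A <= c%:E)%E.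
Proof.
move=> c0 h; apply: ge_ereal_sup => _ [->|[[x y] [/= Ax Ay] <-]].
  by rewrite lee_fin.
by rewrite lee_fin h.
Qed.

Lemma geometric_sum_le (c : K) n : 0 <= c ->
  \sum_(i < n) c / 2 ^+ i.+1 <= c.
Proof.
move=> c0; have -> : \sum_(i < n) c / 2 ^+ i.+1 = c - c / 2 ^+ n.
  elim: n => [|n IH]; first by rewrite big_ord0 expr0 divr1 subrr.
  rewrite big_ord_recr/= IH exprS; field.
  by rewrite expf_neq0// pnatr_eq0.
by rewrite gerBl divr_ge0// exprn_ge0.
Qed.

(** The members of an almost optimal cover are fattened into open sets, with
    radii of small total, and compactness leaves finitely many of them. *)
Lemma path_in_connected S (H eps : K) x y :
  connected S -> compact S -> (hausdorff1 S <= H%:E)%E -> 0 < eps ->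
  S x -> S y ->
  exists q m, [/\ q 0%N = x, q m = y &
    forall s, S s -> exists2 k, (k <= m)%N &
      path_length q m + edistance s (q k) <= H + eps].
Proof.
move=> Sc Sk SH e0 Sx Sy.
(* The cover exceeds [H] by [eps / 4], the fattening by [eps / 8], and the
   meeting of the two chains by [eps / 4 + eps / 8]. *)
pose dl := eps / 4; have dl0 : 0 < dl by rewrite divr_gt0.
have : (hausdorff1_pre dl S < (H + dl)%:E)%E.
  apply: (@le_lt_trans _ _ H%:E); last by rewrite lte_fin ltrDl.
  by apply: le_trans SH; apply: ereal_sup_ubound; exists dl.
move=> /ereal_inf_lt[_ [U [SU Ud] <-] UH].
pose eta (i : nat) := eps / 16 / 2 ^+ i.+1.
have eta0 i : 0 < eta i by rewrite !divr_gt0// exprn_gt0.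
have eta_le i : eta i <= eps / 16.
  rewrite ler_pdivrMr ?exprn_gt0// ler_peMr ?exprn_ege1 ?ler1n//.
  by rewrite divr_ge0 ?ltW.
pose V i := \bigcup_(u in U i) [set z | edistance z u < eta i].
have Vo i : open (V i) by apply: bigcup_open => u _; exact: open_edistance_ball.
have Ufin i : diameter (U i) \is a fin_num.
  by rewrite ge0_fin_numE ?diameter_ge0// (le_lt_trans (Ud i))// ltry.
pose d i := fine (diameter (U i)) + 2 * eta i.
have Vd i u v : V i u -> V i v -> edistance u v <= d i.
  move=> [u' Uu /= uu'] [v' Uv /= vv'].
  have h : edistance u' v' <= fine (diameter (U i)).
    by rewrite -lee_fin fineK// edistance_le_diameter.
  have := edistance_triangle u' u v; have := edistance_triangle v' u' v.
  rewrite (edistanceC v' v) /d; lra.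
have d0 i : 0 <= d i.
  by rewrite addr_ge0 ?mulr_ge0 ?fine_ge0 ?diameter_ge0// ltW.
have SV : S `<=` \bigcup_(i in setT) V i.
  move=> z /SU[i _ Uz]; exists i => //; exists z => //=.
  by rewrite edistancexx.
move: Sk; rewrite compact_cover => /(_ nat setT V (fun i _ => Vo i) SV)[D _ SD].
pose n := (\max_(i <- finmap.enum_fset D) i).+1.
have Dn i : i \in finmap.enum_fset D -> (i < n)%N.
  by move=> iD; rewrite ltnS; exact: (@leq_bigmax_seq _ (finmap.enum_fset D) xpredT id).
have [||q [m [q0 qm qS]]] := @path_in_finite_cover K 'I_n (fun i => V i)
    (fun i => d i) S (fun i => @Vd i) (fun i => d0 i) (fun i => Vo i) _ Sc x y
    (dl + eps / 8) Sx Sy.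
- move=> z /SD[i /= iD Vz]; by exists (Ordinal (Dn _ iD)).
- move=> i; rewrite /d lerD//; last by have := eta_le i; lra.
  by rewrite -lee_fin fineK.
exists q, m; split => // s /qS[k km qk]; exists k => //.
apply: (le_trans qk).
have h1 : \sum_(i < n) fine (diameter (U i)) <= H + dl.
  rewrite -lee_fin -sumEFin; under eq_bigr do rewrite fineK//.
  apply/ltW/le_lt_trans/UH.
  rewrite -(big_mkord xpredT (fun i => diameter (U i))).
  by apply: nneseries_lim_ge => *; exact: diameter_ge0.
have h2 : \sum_(i < n) eta i <= eps / 16 by apply: geometric_sum_le; rewrite divr_ge0// ltW.
have -> : \sum_(i < n) d i = \sum_(i < n) fine (diameter (U i)) + 2 * \sum_(i < n) eta i.
  by rewrite /d big_split/= mulr_sumr.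
move: h1 h2; rewrite /dl; lra.
Qed.

End HausdorffLower.

(** * The dual certificate *)

Section Certificate.
Context {K : realType}.
Implicit Types (x y z s : 'rV[K]_2) (q ys : nat -> 'rV[K]_2).

Lemma path_length_ge (q : nat -> 'rV[K]_2) k1 k2 : (k1 <= k2)%N ->
  edistance (q k1) (q k2) <= \sum_(k1 <= t < k2) edistance (q t) (q t.+1).
Proof.
move=> k12; rewrite -(subnKC k12); elim: (k2 - k1)%N => [|n IH].
  by rewrite addn0 edistancexx big_geq.
rewrite addnS big_nat_recr ?leq_addr//=.
by apply: le_trans (edistance_triangle (q (k1 + n)%N) _ _) _; rewrite lerD2r.
Qed.

Variable u : nat -> 'rV[K]_2.
(** The weight of the dual certificate at the vertex between two edges. *)
Definition kink (i : nat) : 'rV[K]_2 := u i - u i.+1.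
Hypothesis u_unit : forall i, dot (u i) (u i) = 1.
Hypothesis kink_dot_ge0 : forall i j, 0 <= dot (kink i) (kink j).
Hypothesis kink_sum : forall n, \sum_(i < n) enorm (kink i) <= 2^-1.

Lemma sum_kink n : \sum_(i < n) kink i = u 0%N - u n.
Proof.
elim: n => [|n IH]; first by rewrite big_ord0 subrr.
by rewrite big_ord_recr/= IH /kink addrA subrK.
Qed.

(** The vector is [u n + E], where [E] sums the kinks outside [A]. Adding the
    index [n] to the range does not change it when [n] is not in [A]; when [n] is in
    [A], it replaces [u n] by [u n.+1], which does not increase the norm because
    [kink n] has a nonnegative inner product with [E]. *)
Lemma flux_unit (A : pred nat) n :
  enorm (u 0%N - \sum_(i < n | A i) kink i) <= 1.
Proof.
have -> : u 0%N - \sum_(i < n | A i) kink i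
    = u n + \sum_(i < n | ~~ A i) kink i.
  have := sum_kink n; rewrite (bigID (fun i : 'I_n => A i))/= => XY.
  by apply/eqP; rewrite subr_eq -addrA [X in _ + X]addrC XY addrC subrK.
rewrite le_enorm// expr1n; elim: n => [|n IH].
  by rewrite big_ord0 addr0 u_unit.
rewrite big_mkcond big_ord_recr -big_mkcond/=.
set E := (X in u n + X) in IH *.
have [An|An] /= := boolP (A n); last first.
  suff -> : u n.+1 + (E + kink n) = u n + E by [].
  by rewrite /kink addrCA [_ + E]addrC; rewrite [u n.+1 + _]addrC subrK addrC.
have kE : 0 <= dot (kink n) E.
  by rewrite /E dot_sumr sumr_ge0.
rewrite addr0; apply: le_trans IH.
have := u_unit n; have := u_unit n.+1; move: kE; rewrite /kink.
rewrite !dot_lin (dotC E (u n)) (dotC E (u n.+1)); lra.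
Qed.

Lemma flux_near (A : pred nat) n :
  enorm (\sum_(i < n | A i) kink i) <= 2^-1.
Proof.
apply: le_trans (enorm_sum _ _ _) _; apply: le_trans (kink_sum n).
by rewrite [leRHS](bigID (fun i : 'I_n => A i))/= lerDl sumr_ge0// => i _; exact: enorm_ge0.
Qed.

(** The weighted sum of the terminals [x], [ys 0], ..., [ys n.-1], [z] that
    bounds the length of a network joining them from below. *)
Definition dual_value n x z ys : K :=
  dot (u n) z - dot (u 0%N) x + \sum_(i < n) dot (kink i) (ys i).

(** Abel summation: the step from [q t] to [q t.+1] carries the total weight of
    the terminals not yet visited, which is the flux of [flux_unit]. *)
Lemma dual_value_path n q m (k : nat -> nat) : (forall i, (i < n)%N -> (k i <= m)%N) ->
  dual_value n (q 0%N) (q m) (fun i => q (k i)) =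
  \sum_(0 <= t < m) dot (u 0%N - \sum_(i < n | (k i <= t)%N) kink i) (q t.+1 - q t).
Proof.
move=> km.
transitivity (dual_value n (q 0%N) (q m) (fun i => q (minn (k i) m))).
  congr (_ + _); apply: eq_bigr => i _; congr (dot _ (q _)).
  by apply/esym/minn_idPl; exact: km.
elim: m {km} => [|m IH].
  rewrite big_geq// /dual_value; under eq_bigr do rewrite minn0.
  have : dot (\sum_(i < n) kink i) (q 0%N) = \sum_(i < n) dot (kink i) (q 0%N).
    by rewrite dotC dot_sumr; apply: eq_bigr => i _; rewrite dotC.
  by move <-; rewrite sum_kink !dot_lin; ring.
rewrite big_nat_recr//= -IH /dual_value.
have h : \sum_(i < n) dot (kink i) (q (minn (k i) m.+1)) =
    \sum_(i < n) dot (kink i) (q (minn (k i) m)) +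
    dot (\sum_(i < n | ~~ (k i <= m)%N) kink i) (q m.+1 - q m).
  rewrite [dot (\sum_(i < n | _) _) _]dotC dot_sumr [X in _ + X]big_mkcond.
  rewrite -big_split/=; apply: eq_bigr => i _; case: leqP => kim /=.
    by rewrite (minn_idPl (leqW kim)) addr0.
  rewrite (minn_idPr kim) (dotC (q m.+1 - q m)) -dotDr.
  by rewrite addrC subrK.
rewrite h; have := sum_kink n; rewrite (bigID (fun i : 'I_n => (k i <= m)%N))/=.
set X := \sum_(i < n | _) _; set Y := \sum_(i < n | _) _ => XY.
have -> : Y = u 0%N - u n - X by rewrite -XY addrAC subrr add0r.
by rewrite !dot_lin; ring.
Qed.

(** Between the times [k1] and [k2] the bound [flux_near] on the flux is used
    instead of [flux_unit]. It shows that a path which goes backwards with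
    respect to [u 0] is far from optimal. *)
Lemma dual_value_le_path n q m (k : nat -> nat) k1 k2 :
  (forall i, (i < n)%N -> (k i <= m)%N) -> (k1 <= k2 <= m)%N ->
  dual_value n (q 0%N) (q m) (fun i => q (k i)) <=
    path_length q m - 2^-1 * edistance (q k1) (q k2) + dot (u 0%N) (q k2 - q k1).
Proof.
move=> km /andP[k12 k2m]; rewrite dual_value_path//.
have step t : dot (u 0%N - \sum_(i < n | (k i <= t)%N) kink i) (q t.+1 - q t)
    <= edistance (q t) (q t.+1).
  apply: le_trans (dot_le _ _) _; rewrite edistanceC.
  rewrite ler_piMl ?enorm_ge0//.
  exact: (flux_unit (fun i => k i <= t)%N).
have mid t : dot (u 0%N - \sum_(i < n | (k i <= t)%N) kink i) (q t.+1 - q t)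
    <= dot (u 0%N) (q t.+1 - q t) + 2^-1 * edistance (q t) (q t.+1).
  rewrite dotDl lerD2l dotNl lerNl; apply: le_trans (dot_geN _ _).
  rewrite lerN2 edistanceC ler_wpM2r ?enorm_ge0//.
  exact: (flux_near (fun i => (k i <= t)%N)).
have split (F : nat -> K) : \sum_(0 <= t < m) F t =
    \sum_(0 <= t < k1) F t + \sum_(k1 <= t < k2) F t + \sum_(k2 <= t < m) F t.
  by rewrite (big_cat_nat (leq0n k2) k2m)/= (big_cat_nat (leq0n k1) k12).
rewrite /path_length !split.
have h1 := ler_sum_nat (fun t (_ : (0 <= t < k1)%N) => step t).
have h2 := ler_sum_nat (fun t (_ : (k1 <= t < k2)%N) => mid t).
have h3 := ler_sum_nat (fun t (_ : (k2 <= t < m)%N) => step t).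
move: h2; rewrite big_split/= -mulr_sumr.
rewrite -dot_sumr telescope_sumr// => h2.
have := path_length_ge q k12; lra.
Qed.

Lemma dual_value_lip n x z ys ys' (h : K) : 0 <= h ->
  (forall i, (i < n)%N -> edistance (ys i) (ys' i) <= h) ->
  dual_value n x z ys <= dual_value n x z ys' + 2^-1 * h.
Proof.
move=> h0 yy'; rewrite /dual_value -[leRHS]addrA lerD2l.
have : \sum_(i < n) dot (kink i) (ys i) <=
    \sum_(i < n) (dot (kink i) (ys' i) + enorm (kink i) * h).
  apply: ler_sum => i _; rewrite -lerBlDl -dotNr -dotDr.
  apply: le_trans (dot_le _ _) _; rewrite ler_wpM2l ?enorm_ge0//.
  exact: yy'.
rewrite big_split/= -mulr_suml => /le_trans; apply; rewrite lerD2l.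
by rewrite ler_wpM2r// kink_sum.
Qed.

(** Here [h] is the length that is left for the branch. Moving the terminals
    onto the path costs at most [h / 2], so a large [h] is as wasteful as a long
    path. *)
Lemma almost_optimal_path (S : set 'rV[K]_2) (H eps : K) x z :
  connected S -> compact S -> (hausdorff1 S <= H%:E)%E -> 0 < eps ->
  S x -> S z ->
  exists q m h, [/\ [/\ q 0%N = x, q m = z & 0 <= h],
    path_length q m <= H + eps - h,
    forall s, S s -> exists2 k, (k <= m)%N & edistance s (q k) <= h &
    forall n ys k1 k2, (forall i, (i < n)%N -> S (ys i)) -> (k1 <= k2 <= m)%N ->
      dual_value n x z ys <= H + eps - 2^-1 * h
        - 2^-1 * edistance (q k1) (q k2) + dot (u 0%N) (q k2 - q k1)].
Proof.
move=> Sc Sk SH e0 Sx Sz.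
have [q [m [q0 qm qS]]] := path_in_connected Sc Sk SH e0 Sx Sz.
pose h := H + eps - path_length q m.
have near s : S s -> exists2 k, (k <= m)%N & edistance s (q k) <= h.
  by move=> /qS[k km qk]; exists k => //; rewrite /h lerBrDl.
have h0 : 0 <= h.
  by have [k _] := near _ Sx; apply: le_trans; exact: edistance_ge0.
exists q, m, h; split => //; first by rewrite /h opprB addrC subrK.
move=> n ys k1 k2 Sy k12.
have /choice[k kP] : forall i, exists k, (i < n)%N ->
    (k <= m)%N /\ edistance (ys i) (q k) <= h.
  move=> i; have [ni|ni] := ltnP i n; last by exists 0%N.
  by have [k km yk] := near _ (Sy _ ni); exists k.
have km i : (i < n)%N -> (k i <= m)%N by move=> /kP[].
have := @dual_value_lip n x z ys (fun i => q (k i)) h h0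
  (fun i ni => proj2 (kP i ni)).
have := dual_value_le_path q km k12.
rewrite q0 qm /h; lra.
Qed.

End Certificate.

(** * Infinite polygonal lines with small kinks *)

(** The properties of the vertices and edges of Sigma on which the certificate
    rests; the circle enters only through them. The constant [C] is the rate at
    which the directions converge. *)
Record is_chain (K : realType) (a u : nat -> 'rV[K]_2) (l : nat -> K)
    (a_oo u_oo : 'rV[K]_2) (C : K) : Prop := IsChain {
  chain_l0 : 0 < l 0%N;
  chain_lS : forall i, l i.+1 = l i / 2;
  chain_aS : forall i, a i.+1 = a i + l i *: u i;
  chain_unit : forall i, dot (u i) (u i) = 1;
  chain_kink : forall i j, 0 <= dot (kink u i) (kink u j);
  chain_turn : forall n, \sum_(i < n) enorm (kink u i) <= 4^-1;
  chain_unit_oo : dot u_oo u_oo = 1;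
  chain_C : 0 <= C;
  chain_u_lim : forall n, enorm (u n - u_oo) <= C * l n;
  chain_a_lim : forall n, edistance (a n) a_oo <= 2 * l n }.

Section Chain.
Variables (K : realType) (a u : nat -> 'rV[K]_2) (l : nat -> K).
Variables (a_oo u_oo : 'rV[K]_2) (C : K).
Hypothesis ch : is_chain a u l a_oo u_oo C.
Implicit Types (x y z s : 'rV[K]_2) (S : set 'rV[K]_2).

Local Notation a_oo1 := (a_oo + l 0%N *: u_oo).

Lemma edge_gt0 n : 0 < l n.
Proof.
elim: n => [|n IH]; first exact: chain_l0 ch.
by rewrite (chain_lS ch) divr_gt0.
Qed.

Lemma edge_geometric n : l n = l 0%N / 2 ^+ n.
Proof.
elim: n => [|n IH]; first by rewrite expr0 divr1.
by rewrite (chain_lS ch) IH exprSr invfM mulrA.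
Qed.

Lemma edge_nonincreasing n m : (n <= m)%N -> l m <= l n.
Proof.
move=> nm; rewrite (edge_geometric m) (edge_geometric n) ler_wpM2l ?(ltW (edge_gt0 0))//.
by rewrite lef_pV2 ?posrE ?exprn_gt0// ler_weXn2l ?ler1n.
Qed.

Lemma sum_edges n : \sum_(i < n) l i = 2 * l 0%N - 2 * l n.
Proof.
elim: n => [|n IH]; first by rewrite big_ord0 subrr.
by rewrite big_ord_recr/= IH (chain_lS ch); field.
Qed.

Lemma edge_small (e : K) : 0 < e -> exists n, l n <= e.
Proof.
move=> e0; have l0 := chain_l0 ch.
exists (Num.bound (l 0%N / e)); set n := Num.bound _.
have n_gt : l 0%N / e < n%:R by rewrite archi_boundP// divr_ge0 ?ltW.
rewrite (edge_geometric n) ler_pdivrMr ?exprn_gt0//.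
move: n_gt; rewrite ltr_pdivrMr// => /ltW/le_trans; apply.
by rewrite mulrC ler_wpM2l ?ltW// -natrX ltr_nat ltn_expl.
Qed.

Lemma le_edge_limit (X Y c : K) : 0 <= c -> (forall n, X <= Y + c * l n) -> X <= Y.
Proof.
move=> c0 h; apply/ler_addgt0Pr => e e0.
have c1 : 0 < c + 1 by rewrite ltr_wpDl.
have [n ln] := edge_small (divr_gt0 e0 c1).
apply: le_trans (h n) _; rewrite lerD2l.
move: ln; rewrite ler_pdivlMr//; have := edge_gt0 n; nra.
Qed.

Lemma kink_sum_half n : \sum_(i < n) enorm (kink u i) <= 2^-1.
Proof. by apply: le_trans (chain_turn ch n) _; lra. Qed.

Lemma first_edge_dot n : 3 / 4 <= dot (u 0%N) (u n).
Proof.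
have h : enorm (u 0%N - u n) <= 4^-1.
  rewrite -sum_kink; apply: le_trans (enorm_sum _ _ _) _.
  exact: chain_turn ch n.
have := dot_le (u 0%N) (u 0%N - u n).
have -> : enorm (u 0%N) = 1 by apply: enorm_eq; rewrite ?expr1n ?(chain_unit ch).
rewrite !dot_lin (chain_unit ch); lra.
Qed.

Lemma first_edge_dot_oo : 3 / 4 <= dot (u 0%N) u_oo.
Proof.
apply: (@le_edge_limit _ _ C); first exact: chain_C ch.
move=> n; have := first_edge_dot n; have := chain_u_lim ch n.
have := dot_le (u 0%N) (u n - u_oo).
have -> : enorm (u 0%N) = 1 by apply: enorm_eq; rewrite ?expr1n ?(chain_unit ch).
rewrite !dot_lin; lra.
Qed.

Lemma chain_value n z : dual_value u n (a 0%N) z (fun i => a i.+1) =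
  dot (u n) (z - a n) + \sum_(i < n) l i.
Proof.
elim: n z => [|n IH] z; rewrite /dual_value.
  by rewrite !big_ord0 !dot_lin; ring.
have := IH (a n.+1); rewrite /dual_value !big_ord_recr/=.
have -> : dot (u n) (a n.+1 - a n) = l n.
  by rewrite (chain_aS ch) addrC addKr dotZr (chain_unit ch) mulr1.
rewrite /kink !dot_lin; lra.
Qed.

(** The dual value at the vertices tends to the length of the chain. *)
Lemma chain_value_oo n :
  3 * l 0%N - (4 + C * l 0%N) * l n <= dual_value u n (a 0%N) a_oo1 (fun i => a i.+1).
Proof.
rewrite chain_value sum_edges.
have un : enorm (u n) = 1 by apply: enorm_eq; rewrite ?expr1n ?(chain_unit ch).
have h1 : - (2 * l n) <= dot (u n) (a_oo - a n).
  apply: le_trans (dot_geN _ _); rewrite lerN2 un mul1r -/(edistance _ _) edistanceC.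
  exact: chain_a_lim ch n.
have h2 : 1 - C * l n <= dot (u n) u_oo.
  have := dot_geN (u n - u_oo) u_oo; rewrite dotDl dotNl (chain_unit_oo ch).
  have -> : enorm u_oo = 1 by apply: enorm_eq; rewrite ?expr1n ?(chain_unit_oo ch).
  have := chain_u_lim ch n; lra.
have -> : a_oo + l 0%N *: u_oo - a n = a_oo - a n + l 0%N *: u_oo by rewrite addrAC.
rewrite dotDr dotZr; have := edge_gt0 0; nra.
Qed.

(** The finite certificates use the first [n] kinks and end with the weight
    [u n] instead of [u_oo]; the error is of order [l n]. Since each term on the
    left is nonnegative, adding further kinks only strengthens the bound, and
    [n] can be sent to infinity in the error. *)
Lemma chain_lower_bound S (H : K) x z xs :
  connected S -> compact S -> (hausdorff1 S <= H%:E)%E ->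
  S x -> S z -> (forall i, S (xs i)) ->
  dot (u 0%N) (x - a 0%N) <= 0 ->
  (forall i, 0 <= dot (kink u i) (xs i - a i.+1)) ->
  0 <= dot u_oo (z - a_oo1) ->
  forall n, 3 * l 0%N + dot u_oo (z - a_oo1) - dot (u 0%N) (x - a 0%N)
    + \sum_(i < n) dot (kink u i) (xs i - a i.+1) <= H.
Proof.
move=> Sc Sk SH Sx Sz Sxs hx hxs hz n.
apply: (@le_edge_limit _ _ (C * enorm (z - a_oo1) + (4 + C * l 0%N))).
  have := chain_C ch; have := edge_gt0 0; have := enorm_ge0 (z - a_oo1).
  by move=> *; rewrite !addr_ge0 ?mulr_ge0// ltW.
(* [n] counts the kinks that are kept, [m] controls the error. *)
move=> m; pose N := maxn n m.
have valH : dual_value u N x z xs <= H.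
  apply/ler_addgt0Pr => e e0.
  have [q [p [h [[q0 qp h0] _ _]]]] := almost_optimal_path
    (chain_unit ch) (chain_kink ch) kink_sum_half Sc Sk SH e0 Sx Sz.
  move=> /(_ N xs 0%N 0%N (fun i _ => Sxs i) isT).
  rewrite edistancexx subrr dot0r; lra.
have dif : dual_value u N x z xs = dual_value u N (a 0%N) a_oo1 (fun i => a i.+1)
   + dot (u N) (z - a_oo1) - dot (u 0%N) (x - a 0%N)
   + \sum_(i < N) dot (kink u i) (xs i - a i.+1).
  rewrite /dual_value; have -> : \sum_(i < N) dot (kink u i) (xs i - a i.+1) =
      \sum_(i < N) dot (kink u i) (xs i) - \sum_(i < N) dot (kink u i) (a i.+1).
    by rewrite -sumrB; apply: eq_bigr => i _; rewrite !dot_lin.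
  by rewrite !dot_lin; ring.
have mono : \sum_(i < n) dot (kink u i) (xs i - a i.+1) <=
    \sum_(i < N) dot (kink u i) (xs i - a i.+1).
  rewrite (big_ord_widen _ (fun i => dot (kink u i) (xs i - a i.+1)) (leq_maxl n m)).
  rewrite -/N [leRHS](bigID (fun i : 'I_N => (i < n)%N))/=.
  by rewrite lerDl sumr_ge0.
have endp : dot u_oo (z - a_oo1) - C * l N * enorm (z - a_oo1) <= dot (u N) (z - a_oo1).
  have := dot_geN (u N - u_oo) (z - a_oo1); rewrite dotDl dotNl.
  have := chain_u_lim ch N; have := enorm_ge0 (z - a_oo1); nra.
have := chain_value_oo N; have := edge_nonincreasing (leq_maxr n m); rewrite -/N => lNm.
have C0 := chain_C ch; have l0 := edge_gt0 0; have e0 := enorm_ge0 (z - a_oo1).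
have : (C * enorm (z - a_oo1) + (4 + C * l 0%N)) * l N <=
    (C * enorm (z - a_oo1) + (4 + C * l 0%N)) * l m.
  by rewrite ler_wpM2l// !addr_ge0 ?mulr_ge0// ltW.
move: valH; rewrite dif; lra.
Qed.

(** The chain advances in the direction of its first edge: [before x y] says
    that [y - x] lies in a narrow cone around that direction. *)
Definition before x y : Prop := enorm (y - x) <= 2 * dot (u 0%N) (y - x).

Lemma before_trans y x z : before x y -> before y z -> before x z.
Proof.
rewrite /before => xy yz; have -> : z - x = (y - x) + (z - y) by rewrite [RHS]addrC subrKA.
rewrite dotDr; have := enormD (y - x) (z - y); lra.
Qed.

Lemma before_ray x w (t : K) : dot w w = 1 -> 3 / 4 <= dot (u 0%N) w -> 0 <= t ->
  before x (x + t *: w).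
Proof.
move=> w1 uw t0; rewrite /before addrC addKr enormZ dotZr ger0_norm//.
have -> : enorm w = 1 by apply: enorm_eq; rewrite ?expr1n.
nra.
Qed.

Lemma before_edge i (t : K) : 0 <= t -> before (a i) (a i + t *: u i).
Proof. exact: before_ray (chain_unit ch i) (first_edge_dot i). Qed.

Lemma before_a i j : (i <= j)%N -> before (a i) (a j).
Proof.
move=> ij; rewrite -(subnKC ij); elim: (j - i)%N => [|n IH].
  by rewrite addn0 /before subrr enorm0 dot0r mulr0.
apply: before_trans IH _; rewrite addnS (chain_aS ch).
by apply: before_edge; rewrite ltW// edge_gt0.
Qed.

Lemma before_a_oo i : before (a i) a_oo.
Proof.
apply: (@le_edge_limit _ _ 6) => // n; pose N := maxn i n.
have h := before_a (leq_maxl i n); rewrite /before -/N in h.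
have h1 := enormD (a N - a i) (a_oo - a N).
have h2 := chain_a_lim ch N; rewrite edistanceC /edistance in h2.
have h3 := dot_geN (u 0%N) (a_oo - a N).
have u1 : enorm (u 0%N) = 1 by apply: enorm_eq; rewrite ?expr1n ?(chain_unit ch).
have h4 := edge_nonincreasing (leq_maxr i n); rewrite -/N in h4.
have e : a_oo - a i = (a N - a i) + (a_oo - a N) by rewrite [RHS]addrC subrKA.
rewrite u1 in h3; rewrite -e in h1; rewrite e dotDr -e; lra.
Qed.

Definition chain_set : set 'rV[K]_2 :=
  (\bigcup_i segment (a i) (a i.+1)) `|` segment a_oo a_oo1.

Lemma segment_edgeP i x : segment (a i) (a i.+1) x ->
  exists2 t, 0 <= t <= l i & x = a i + t *: u i.
Proof.
move=> [t /= /andP[t0 t1] <-]; exists (t * l i).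
  have := edge_gt0 i; nra.
by rewrite segmentB (chain_aS ch) [a i + _ - _]addrC addKr scalerA.
Qed.

Lemma before_edge_end i x : segment (a i) (a i.+1) x -> before x (a i.+1).
Proof.
move=> /segment_edgeP[t /andP[t0 tl] ->].
have -> : a i.+1 = (a i + t *: u i) + (l i - t) *: u i.
  by rewrite (chain_aS ch) -addrA -scalerDl addrCA subrr addr0.
by apply: before_ray; rewrite ?(chain_unit ch) ?first_edge_dot ?subr_ge0.
Qed.

Lemma before_edge_start i x : segment (a i) (a i.+1) x -> before (a i) x.
Proof.
by move=> /segment_edgeP[t /andP[t0 tl] ->]; exact: before_edge.
Qed.

Lemma before_last x y : segment a_oo a_oo1 x -> segment a_oo a_oo1 y ->
  before x y \/ before y x.
Proof.
move=> [t _ <-] [t' _ <-].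
wlog tt' : t t' / t <= t'.
  move=> h; have [|/ltW] := leP t t'; first exact: h.
  by move=> /h[]; [right|left].
left; rewrite !segmentB [a_oo + _ - _]addrC addKr !scalerA.
have -> : a_oo + (t' * l 0%N) *: u_oo =
    (a_oo + (t * l 0%N) *: u_oo) + ((t' - t) * l 0%N) *: u_oo.
  by rewrite -addrA -scalerDl -mulrDl addrCA subrr addr0.
apply: before_ray; rewrite ?(chain_unit_oo ch) ?first_edge_dot_oo//.
by rewrite mulr_ge0 ?subr_ge0// ltW// edge_gt0.
Qed.

Lemma before_oo x : segment a_oo a_oo1 x -> before a_oo x.
Proof.
move=> [t /= /andP[t0 t1] <-]; rewrite segmentB [a_oo + _ - _]addrC addKr scalerA.
apply: before_ray; rewrite ?(chain_unit_oo ch) ?first_edge_dot_oo//.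
by rewrite mulr_ge0// ltW// edge_gt0.
Qed.

(** Along the chain all directions are close to that of the first edge, so
    displacements add up inside the cone. *)
Lemma before_total x y : chain_set x -> chain_set y -> before x y \/ before y x.
Proof.
have edge_edge i j x' y' : (i < j)%N -> segment (a i) (a i.+1) x' ->
    segment (a j) (a j.+1) y' -> before x' y'.
  move=> ij /before_edge_end xi /before_edge_start yj.
  exact: before_trans xi (before_trans (before_a ij) yj).
have edge_last i x' y' : segment (a i) (a i.+1) x' -> segment a_oo a_oo1 y' ->
    before x' y'.
  move=> /before_edge_end xi /before_oo yj.
  exact: before_trans xi (before_trans (before_a_oo _) yj).
move=> [[i _ xi]|xl] [[j _ yj]|yl].
- have [ij|ji|ij] := ltngtP i j; [left|right|]; [exact: edge_edge xi yj|exact: edge_edge yj xi|].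
  subst j; move: xi yj => /segment_edgeP[t _ ->] /segment_edgeP[t' _ ->].
  wlog tt' : t t' / t <= t'.
    move=> h; have [|/ltW] := leP t t'; first exact: h.
    by move=> /h[]; [right|left].
  left; have -> : a i + t' *: u i = (a i + t *: u i) + (t' - t) *: u i.
    by rewrite -addrA -scalerDl addrCA subrr addr0.
  by apply: before_ray; rewrite ?(chain_unit ch) ?first_edge_dot ?subr_ge0.
- by left; exact: edge_last xi yl.
- by right; exact: edge_last yj xl.
- exact: before_last.
Qed.

Lemma chain_set_inj x y : chain_set x -> chain_set y ->
  dot (u 0%N) x = dot (u 0%N) y -> x = y.
Proof.
move=> cx cy e.
have h x' y' : dot (u 0%N) x' = dot (u 0%N) y' -> before x' y' -> x' = y'.
  rewrite /before dotDr dotNr => ->; rewrite subrr mulr0 => b.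
  apply/esym/edistance_eq0/eqP; rewrite eq_le edistance_ge0 andbT.
  exact: b.
by have [/h|/h] := before_total cx cy; [exact|move=> ->].
Qed.

End Chain.

(** * Compactness, connectedness and finite covers in the plane *)

(** If a filter does not cluster at [p], it lives on [D] and finitely many of
    the [A i]. *)
Lemma compact_bigcup_cvg (T : topologicalType) (A : nat -> set T) (D : set T) (p : T) :
  (forall i, compact (A i)) -> compact D -> D p ->
  (forall W, nbhs p W -> exists n, forall i, (n <= i)%N -> A i `<=` W) ->
  compact (\bigcup_i A i `|` D).
Proof.
move=> cA cD Dp Ap F FF FA.
have [cFp|] := pselect (cluster F p); first by exists p; split => //; right.
move=> /existsNP[G /existsNP[W /not_implyP[FG /not_implyP[pW GW]]]].
have [n An] := Ap _ pW.
pose B := \big[setU/set0]_(i < n) A i `|` D.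
have cB : compact B by apply: compactU => //; apply: bigsetU_compact => i _.
have FB : F B.
  apply: filterS (filterI FA FG) => x [[[i _ Aix]|Dx] Gx]; last by right.
  left; have [ni|ni] := ltnP i n.
    by rewrite -bigcup_mkord; exists i.
  by exfalso; apply: GW; exists x; split => //; exact: An Aix.
have [q [Bq cFq]] := cB _ FF FB.
exists q; split => //; case: Bq => [|Dq]; last by right.
by rewrite -bigcup_mkord => -[i _ Aiq]; left; exists i.
Qed.

Section PlaneTopology.
Context {K : realType}.
Implicit Types (delta c : K) (x y : 'rV[K]_2) (A B : set 'rV[K]_2).

Lemma segment_param_continuous x y :
  continuous (fun t : K => (1 - t) *: x + t *: y : 'rV[K]_2).
Proof.
rewrite (_ : (fun t => _) = fun t => x + t *: (y - x)); last first.
  by apply/funext => t; rewrite segmentB.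
move=> t; apply: (@continuousD _ _ _ (fun=> x) (fun t : K => t *: (y - x))).
  exact: cst_continuous.
exact: scalel_continuous.
Qed.

Lemma segment_imageE x y : segment x y =
  (fun t : K => (1 - t) *: x + t *: y) @` [set` `[0, 1]].
Proof. by congr (_ @` _); apply/seteqP; split => t /=; rewrite in_itv. Qed.

Lemma compact_segment x y : compact (segment x y).
Proof.
rewrite segment_imageE; apply: continuous_compact; last exact: segment_compact.
apply: continuous_subspaceT; exact: segment_param_continuous.
Qed.

Lemma connected_segment x y : connected (segment x y).
Proof.
rewrite segment_imageE; apply: connected_continuous_connected.
  exact: segment_connected.
apply: continuous_subspaceT; exact: segment_param_continuous.
Qed.

Lemma compact_closed_plane A : compact A -> closed A.
Proof. by apply: compact_closed; exact: norm_hausdorff. Qed.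

Lemma closed_edistance A x : closed A ->
  (forall e, 0 < e -> exists2 y, A y & edistance y x <= e) -> A x.
Proof.
move=> cA h; have [//|nA] := pselect (A x).
have /nbhs_edistance[e e0 he] : nbhs x (~` A).
  by apply: open_nbhs_nbhs; split => //; rewrite openC.
have [|y Ay yx] := h (e / 2); first by rewrite divr_gt0.
by exfalso; apply: (he y) Ay; apply: le_lt_trans yx _; lra.
Qed.

(** An explicit upper bound for the premeasure: finitely many sets, with
    bounds on their diameters that add up to at most [c]. *)
Definition finite_cover (delta : K) A (c : K) : Prop :=
  exists (N : nat) (U : nat -> set 'rV[K]_2) (d : nat -> K),
  [/\ forall x, A x -> exists2 i, (i < N)%N & U i x,
      forall i, 0 <= d i <= delta,
      forall i x y, U i x -> U i y -> edistance x y <= d i &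
      \sum_(i < N) d i <= c].

Lemma finite_cover_pre delta A c : finite_cover delta A c ->
  (hausdorff1_pre delta A <= c%:E)%E.
Proof.
move=> [N [U [d [AU d_bd dU dc]]]].
pose V i := if (i < N)%N then U i else set0.
pose e i := if (i < N)%N then d i else 0.
have e0 i : 0 <= e i.
  by rewrite /e; case: ifP => // _; have /andP[] := d_bd i.
have Ve i : (diameter (V i) <= (e i)%:E)%E.
  by apply: diameter_le => // x y; rewrite /V /e; case: ifP => // _; exact: dU.
apply: (@le_trans _ _ (\sum_(0 <= i <oo) diameter (V i))%E).
  apply: ereal_inf_lbound; exists V => //; split.
    by move=> x /AU[i iN Ux]; exists i => //; rewrite /V iN.
  move=> i; apply: le_trans (Ve i) _; rewrite lee_fin /e.
  have /andP[d0 dd] := d_bd i; case: ifP => // _; exact: le_trans dd.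
apply: lime_le; first by apply: is_cvg_nneseries => i _ _; exact: diameter_ge0.
apply: nearW => n; apply: (@le_trans _ _ (\sum_(0 <= i < n) (e i)%:E)%E).
  by apply: lee_sum => i _; exact: Ve.
rewrite sumEFin lee_fin; apply: le_trans dc.
rewrite big_mkord; apply: (@le_trans _ _ (\sum_(i < N + n) e i)).
  by rewrite addnC big_split_ord/= lerDl sumr_ge0.
rewrite big_split_ord/= [X in _ + X]big1 ?addr0.
  by apply: ler_sum => i _; rewrite /e ltn_ord.
by move=> i _; rewrite /e ltnNge leq_addr.
Qed.

Lemma finite_coverU delta A B c c' : finite_cover delta A c -> finite_cover delta B c' ->
  finite_cover delta (A `|` B) (c + c').
Proof.
move=> [N [U [d [AU d_bd dU dc]]]] [N' [U' [d' [AU' d_bd' dU' dc']]]].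
exists (N + N')%N, (fun i => if (i < N)%N then U i else U' (i - N)%N),
  (fun i => if (i < N)%N then d i else d' (i - N)%N); split.
- move=> x [/AU[i iN Ux]|/AU'[i iN Ux]].
    by exists i; rewrite ?ltn_addr// iN.
  by exists (N + i)%N; rewrite ?ltn_add2l// ltnNge leq_addr/= addKn.
- by move=> i; case: ifP.
- by move=> i x y; case: ifP => _; [exact: dU|exact: dU'].
- rewrite big_split_ord/= lerD//.
    by apply: le_trans dc; apply: ler_sum => i _; rewrite ltn_ord.
  apply: le_trans dc'; apply: ler_sum => i _.
  by rewrite ltnNge leq_addr/= addKn.
Qed.

Lemma finite_cover1 delta A c : 0 <= c -> c <= delta ->
  (forall x y, A x -> A y -> edistance x y <= c) -> finite_cover delta A c.
Proof.
move=> c0 cd Ac; exists 1%N, (fun=> A), (fun=> c); split => //.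
- by move=> x Ax; exists 0%N.
- by move=> i; rewrite c0.
- by rewrite big_ord1.
Qed.

Lemma finite_cover_sub delta A B c c' : A `<=` B -> c' <= c ->
  finite_cover delta B c' -> finite_cover delta A c.
Proof.
move=> AB cc [N [U [d [AU d_bd dU dc]]]]; exists N, U, d; split => //.
  by move=> x /AB/AU.
exact: le_trans cc.
Qed.

Lemma finite_cover_segment delta x y : 0 < delta ->
  finite_cover delta (segment x y) (edistance x y).
Proof.
move=> dl0; pose D := edistance x y; have D0 : 0 <= D := edistance_ge0 x y.
pose k := (Num.bound (D / delta)).+1.
have k0 : 0 < k%:R :> K by rewrite ltr0n.
have kD : D / k%:R <= delta.
  rewrite ler_pdivrMr// mulrC -ler_pdivrMr//.
  apply: ltW; apply: (@lt_le_trans _ _ (Num.bound (D / delta))%:R).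
    by rewrite archi_boundP// divr_ge0// ltW.
  by rewrite ler_nat.
pose P t := (1 - t) *: x + t *: y.
have PD (b t : K) : edistance (P b) (P t) = `|b - t| * D.
  rewrite /edistance /P !segmentB opprD addrACA subrr add0r -scalerBl enormZ.
  by rewrite -enormN opprB.
have h j : finite_cover delta (P @` [set t | 0 <= t <= j%:R / k%:R]) (j%:R * (D / k%:R)).
  elim: j => [|j IH].
    apply: (@finite_cover_sub _ _ [set x] _ 0).
    - move=> _ [t /= ht <-]; have -> : t = 0.
        by move: ht; rewrite mul0r => ?; apply/eqP; rewrite eq_le andbC.
      by rewrite /P subr0 scale1r scale0r addr0.
    - by rewrite mul0r.
    - apply: finite_cover1 => //; first exact: ltW.
      by move=> _ _ -> ->; rewrite edistancexx.
  have -> : j.+1%:R * (D / k%:R) = j%:R * (D / k%:R) + D / k%:R.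
    by rewrite -natr1 mulrDl mul1r.
  apply: (@finite_cover_sub _ _ (P @` [set t | 0 <= t <= j%:R / k%:R] `|`
     P @` [set t | j%:R / k%:R <= t <= j.+1%:R / k%:R]) _ _) (lexx _) _.
    move=> _ [t /= /andP[t0 t1] <-].
    have [tj|/ltW tj] := leP t (j%:R / k%:R); [left|right]; exists t => //=.
      by rewrite t0.
    by rewrite tj.
  apply: finite_coverU IH _; apply: finite_cover1 => //.
    by rewrite divr_ge0// ltW.
  move=> _ _ [b /= /andP[s0 s1] <-] [t /= /andP[t0 t1] <-]; rewrite PD.
  rewrite mulrC ler_wpM2l// ler_norml.
  move: s1 t1; rewrite -natr1 mulrDl mul1r => s1 t1.
  by apply/andP; split; lra.
apply: finite_cover_sub (h k).
  by move=> _ [t ht <-]; exists t => //=; rewrite divff// gt_eqF.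
by rewrite mulrC divfK ?gt_eqF.
Qed.

End PlaneTopology.

(** * Topology and length of the chain *)

Section ChainTopology.
Variables (K : realType) (a u : nat -> 'rV[K]_2) (l : nat -> K).
Variables (a_oo u_oo : 'rV[K]_2) (C : K).
Hypothesis ch : is_chain a u l a_oo u_oo C.
Implicit Types (x y z s : 'rV[K]_2) (S : set 'rV[K]_2).

Local Notation a_oo1 := (a_oo + l 0%N *: u_oo).
Local Notation Sigma := (chain_set a l a_oo u_oo).

Lemma edistance_edge i : edistance (a i) (a i.+1) = l i.
Proof.
rewrite edistanceC /edistance (chain_aS ch) addrC addKr enormZ.
rewrite ger0_norm ?ltW ?(edge_gt0 ch)//.
by rewrite (@enorm_eq _ _ 1) ?mulr1// expr1n (chain_unit ch).
Qed.

Lemma edistance_last : edistance a_oo a_oo1 = l 0%N.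
Proof.
rewrite edistanceC /edistance addrC addKr enormZ ger0_norm ?ltW ?(edge_gt0 ch)//.
by rewrite (@enorm_eq _ _ 1) ?mulr1// expr1n (chain_unit_oo ch).
Qed.

Lemma edge_near_limit i x : segment (a i) (a i.+1) x -> edistance x a_oo <= 3 * l i.
Proof.
move=> /segment_edistance; rewrite edistance_edge => xi.
have := edistance_triangle (a i) x a_oo; have := chain_a_lim ch i; lra.
Qed.

Lemma chain_set_compact : compact Sigma.
Proof.
apply: (compact_bigcup_cvg (p := a_oo)).
- by move=> i; exact: compact_segment.
- exact: compact_segment.
- exact: segment_left.
- move=> W /nbhs_edistance[e e0 We].
  have [|n ln] := edge_small ch (e := e / 4); first by rewrite divr_gt0.
  exists n => i ni x /edge_near_limit xi; apply: We.
  have := edge_nonincreasing ch ni; lra.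
Qed.

Lemma chain_set_connected : connected Sigma.
Proof.
pose B n := \bigcup_(i in [set i | (i <= n)%N]) segment (a i) (a i.+1).
have B0 n : B n (a 0%N) by exists 0%N => //; exact: segment_left.
have cB n : connected (B n).
  elim: n => [|n IH].
    have -> : B 0%N = segment (a 0%N) (a 1%N).
      apply/seteqP; split => [x [i /=]|x ?]; last by exists 0%N.
      by rewrite leqn0 => /eqP ->.
    exact: connected_segment.
  have -> : B n.+1 = B n `|` segment (a n.+1) (a n.+2).
    apply/seteqP; split => [x [i /=]|x [[i /= ni xi]|xn]].
    - rewrite leq_eqVlt => /predU1P[->|ni xi]; [by right|by left; exists i].
    - by exists i => //=; exact: leqW.
    - by exists n.+1 => /=.
  apply: connectedU => //; last exact: connected_segment.
  exists (a n.+1); split; last exact: segment_left.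
  by exists n => /=; [|exact: segment_right].
(* The last segment is attached at [a_oo], which lies in the closure of the
   union of the edges. *)
pose A := \bigcup_i segment (a i) (a i.+1).
have cA : connected A.
  have -> : A = \bigcup_n B n.
    apply/seteqP; split => [x [i _ xi]|x [n _ [i _ xi]]]; last by exists i.
    by exists i => //; exists i => /=.
  apply: bigcup_connected => // ; exists (a 0%N) => n _; exact: B0.
have clA : closure A a_oo.
  apply: (closed_edistance (@closed_closure _ A)) => e e0.
  have [|n ln] := edge_small ch (e := e / 2); first by rewrite divr_gt0.
  exists (a n); first by apply: subset_closure; exists n => //; exact: segment_left.
  by apply: le_trans (chain_a_lim ch n) _; lra.
have -> : Sigma = closure A `|` segment a_oo a_oo1.
  apply/seteqP; split => [x [xA|xl]|x [xA|xl]]; [left|by right| |by right].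
    exact: subset_closure.
  have /closure_id -> : closed Sigma by apply: compact_closed_plane; exact: chain_set_compact.
  by apply: closureS xA => y Ay; left.
apply: connectedU; [|exact: connected_closure|exact: connected_segment].
by exists a_oo; split => //; exact: segment_left.
Qed.

(** All but finitely many edges lie in one set of small diameter. *)
Lemma chain_set_hausdorff : (hausdorff1 Sigma <= (3 * l 0%N)%:E)%E.
Proof.
have l0 := edge_gt0 ch 0.
apply: ge_ereal_sup => _ [dl /= dl0 <-].
apply/lee_addgt0Pr => e e0; rewrite -EFinD.
have m0 : 0 < Num.min dl e by rewrite lt_min dl0.
have [n ln] := edge_small ch (divr_gt0 m0 (ltr0n K 6 : 0 < 6)).
have lnd : 6 * l n <= dl by move: ln; rewrite ler_pdivlMr// le_min; lra.
have lne : 6 * l n <= e by move: ln; rewrite ler_pdivlMr// le_min; lra.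
apply: finite_cover_pre.
have tail : finite_cover dl (\bigcup_(i in [set i | (n <= i)%N]) segment (a i) (a i.+1))
    (6 * l n).
  apply: finite_cover1 => //; first by have := edge_gt0 ch n; lra.
  move=> x y [i /= ni /edge_near_limit xi] [j /= nj /edge_near_limit yj].
  have := edistance_triangle a_oo x y; rewrite (edistanceC a_oo).
  have := edge_nonincreasing ch ni; have := edge_nonincreasing ch nj; lra.
have head : forall k, finite_cover dl (\bigcup_(i in [set i | (i < k)%N])
    segment (a i) (a i.+1)) (\sum_(i < k) l i).
  elim=> [|k IH].
    apply: (@finite_cover_sub _ _ _ set0 _ 0); rewrite ?big_ord0//.
      by move=> x [].
    by apply: finite_cover1 => //; exact: ltW.
  rewrite big_ord_recr/=.
  have := finite_coverU IH (finite_cover_segment (a k) (a k.+1) dl0).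
  rewrite edistance_edge; apply: finite_cover_sub => // x [i /=].
  rewrite ltnS leq_eqVlt => /predU1P[->|ik xi]; [by right|by left; exists i].
have := finite_coverU (finite_coverU (head n) tail) (finite_cover_segment a_oo a_oo1 dl0).
apply: finite_cover_sub.
  move=> x [[i _ xi]|xl]; last by right.
  by left; have [ni|ni] := leqP n i; [right|left]; exists i.
rewrite edistance_last (sum_edges ch); have := edge_gt0 ch n; lra.
Qed.

End ChainTopology.

(** * Uniqueness *)

Section Excess.
Context {K : realType}.
Implicit Types (x y s : 'rV[K]_2).

(** If going from [x] to [y] through [s] costs little more than going
    straight, then [s] is close to the segment: the point dividing the segment
    in the ratio of the two distances is close to [s], by Stewart's theorem. *)
Lemma segment_near_of_excess x y s (tau : K) :
  edistance x s + edistance s y <= edistance x y + tau ->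
  exists2 p, segment x y p &
    edistance s p ^+ 2 <= tau * (2 * edistance x y + tau) / 4.
Proof.
move=> h; set D := edistance x y in h *.
set A := edistance x s in h; set B := edistance s y in h.
have tri : D <= A + B := edistance_triangle s x y.
have A0 : 0 <= A := edistance_ge0 _ _; have B0 : 0 <= B := edistance_ge0 _ _.
have D0 : 0 <= D := edistance_ge0 _ _.
have tau0 : 0 <= tau by lra.
have [AB0|ABn0] := eqVneq (A + B) 0.
  have A_0 : A = 0 by lra.
  exists x; first exact: segment_left.
  rewrite edistanceC -/A A_0 expr0n/= divr_ge0// mulr_ge0// addr_ge0// mulr_ge0//.
have AB0 : 0 < A + B by rewrite lt_neqAle eq_sym ABn0 addr_ge0.
pose t := A / (A + B).
have t0 : 0 <= t by rewrite divr_ge0// ltW.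
have t1 : t <= 1 by rewrite ler_pdivrMr// mul1r lerDl.
exists ((1 - t) *: x + t *: y); first by exists t => //=; rewrite t0.
have AE : A ^+ 2 = dot (s - x) (s - x) by rewrite /A edistanceC enorm_sqr.
have BE : B ^+ 2 = dot (s - y) (s - y) by rewrite /B enorm_sqr.
have DE : D ^+ 2 = dot (x - y) (x - y) by rewrite /D enorm_sqr.
have stewart : edistance s ((1 - t) *: x + t *: y) ^+ 2 =
    (1 - t) * A ^+ 2 + t * B ^+ 2 - t * (1 - t) * D ^+ 2.
  by rewrite enorm_sqr AE BE DE !dotE !mxE; ring.
have e : edistance s ((1 - t) *: x + t *: y) ^+ 2 =
    A * B * ((A + B) ^+ 2 - D ^+ 2) / (A + B) ^+ 2.
  by rewrite stewart /t; field.
rewrite e ler_pdivrMr ?exprn_gt0//.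
have h1 : A * B <= (A + B) ^+ 2 / 4 by have := sqr_ge0 (A - B); lra.
have h2 : (A + B) ^+ 2 - D ^+ 2 <= tau * (2 * D + tau) by nra.
have h3 : 0 <= (A + B) ^+ 2 - D ^+ 2 by nra.
have h4 : 0 <= A * B by rewrite mulr_ge0.
have := ler_pM h4 h3 h1 h2; lra.
Qed.

Lemma sum_monotone_index (k : nat -> nat) (F e : nat -> K) N :
  (forall i, (i < N)%N -> (k i <= k i.+1)%N) ->
  (forall i, (i < N)%N -> F i <= \sum_(k i <= t < k i.+1) e t) ->
  (k 0%N <= k N)%N /\ \sum_(i < N) F i <= \sum_(k 0%N <= t < k N) e t.
Proof.
elim: N => [|N IH] kmono FE.
  by rewrite leqnn big_ord0 big_geq.
have [kN FN] := IH (fun i iN => kmono i (leqW iN)) (fun i iN => FE i (leqW iN)).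
have kNN := kmono N (leqnn _).
split; first exact: leq_trans kNN.
by rewrite big_ord_recr/= (big_cat_nat kN kNN) lerD// FE.
Qed.

Lemma monotone_index_locate (k : nat -> nat) N t : (k 0%N <= t)%N -> (t <= k N.+1)%N ->
  exists2 j, (j <= N)%N & (k j <= t <= k j.+1)%N.
Proof.
move=> k0; elim: N => [|N IH] tN; first by exists 0%N; rewrite ?k0.
have [kt|/ltnW/IH[j jN tj]] := leqP (k N.+1) t; first by exists N.+1; rewrite ?kt.
by exists j => //; exact: leqW.
Qed.

End Excess.

Section Uniqueness.
Variables (K : realType) (a u : nat -> 'rV[K]_2) (l : nat -> K).
Variables (a_oo u_oo : 'rV[K]_2) (C : K).
Hypothesis ch : is_chain a u l a_oo u_oo C.
Implicit Types (x y z s p : 'rV[K]_2).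

Local Notation a_oo1 := (a_oo + l 0%N *: u_oo).
Local Notation Sigma := (chain_set a l a_oo u_oo).

Variable S : set 'rV[K]_2.
Hypothesis S_connected : connected S.
Hypothesis S_compact : compact S.
Hypothesis S_length : (hausdorff1 S <= (3 * l 0%N)%:E)%E.
Hypothesis S_a : forall i, S (a i).
Hypothesis S_end : S a_oo1.

(** For a competitor of minimal length the certificate with many kinks is almost
    tight, so both the branch and the backward moves become arbitrarily small. *)
Lemma near_optimal_path (eta : K) : 0 < eta -> exists q m,
  [/\ q 0%N = a 0%N /\ q m = a_oo1,
    path_length q m <= 3 * l 0%N + eta,
    forall s, S s -> exists2 k, (k <= m)%N & edistance s (q k) <= eta &
    forall k1 k2, (k1 <= k2 <= m)%N ->
      2^-1 * edistance (q k1) (q k2) <= dot (u 0%N) (q k2 - q k1) + eta].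
Proof.
move=> eta0; have eps0 : 0 < eta / 8 by rewrite divr_gt0.
have [q [m [h [[q0 qm h0] qlen qS qdual]]]] := almost_optimal_path
  (chain_unit ch) (chain_kink ch) (kink_sum_half ch) S_connected S_compact S_length eps0
  (S_a 0) S_end.
have C1 : 0 < 4 + C * l 0%N.
  by rewrite ltr_pwDl// mulr_ge0 ?(chain_C ch)// ltW// (edge_gt0 ch).
have [n ln] := edge_small ch (divr_gt0 eps0 C1).
have val := chain_value_oo ch n.
have vn : (4 + C * l 0%N) * l n <= eta / 8 by rewrite mulrC -ler_pdivlMr.
have dual k1 k2 (k12 : (k1 <= k2 <= m)%N) :=
  qdual n (fun i => a i.+1) k1 k2 (fun i _ => S_a i.+1) k12.
have hle : h <= eta.
  have := dual 0%N 0%N isT; rewrite edistancexx subrr dot0r; lra.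
exists q, m; split => //; first by lra.
- by move=> s /qS[k km qk]; exists k => //; exact: le_trans qk hle.
- by move=> k1 k2 /dual; lra.
Qed.

(** The chain in which everything after [a n] is replaced by one segment to the
    end point, which has the index [n.+1]. *)
Let vertex n i : 'rV[K]_2 := if (i <= n)%N then a i else a_oo1.

(** Replacing the tail of the chain after [a n] by one segment shortens it by an
    amount of order [l n]. *)
Lemma vertex_sum n : 3 * l 0%N - 4 * l n <=
  \sum_(i < n.+1) edistance (vertex n i) (vertex n i.+1).
Proof.
rewrite big_ord_recr/= /vertex leqnn ltnn.
under eq_bigr => i _ do rewrite (ltnW (ltn_ord i)) ltn_ord (edistance_edge ch).
rewrite (sum_edges ch).
have := edistance_triangle (a n) a_oo a_oo1; rewrite (edistance_last ch) edistanceC.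
have := chain_a_lim ch n; have := edge_gt0 ch n; lra.
Qed.

(** A near-optimal path visits the first vertices of the chain in their order,
    so a point of [S] is visited between two consecutive ones, and then it lies
    near the segment joining them. *)
Lemma between_vertices n s : S s -> exists2 j, (j <= n)%N &
  edistance (vertex n j) s + edistance s (vertex n j.+1)
    <= edistance (vertex n j) (vertex n j.+1) + 5 * l n.
Proof.
(* The [n.+1] edges cost an error of [4 * eta] each; together with the excess
   [eta] of the path this is at most [l n]. *)
move=> Ss; pose eta := l n / (8 * n.+2%:R).
have ln0 := edge_gt0 ch n.
have n2 : 0 < n.+2%:R :> K by rewrite ltr0n.
have eta0 : 0 < eta by rewrite divr_gt0// mulr_gt0.
have etaE : 8 * n.+2%:R * eta = l n.
  by rewrite /eta mulrC divfK// mulf_neq0// gt_eqF.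
have eta_small : 16 * eta <= l n.
  rewrite -etaE ler_wpM2r ?(ltW eta0)//.
  have : 2 <= n.+2%:R :> K by rewrite ler_nat.
  lra.
have [q [m [[q0 qm] qlen qS qdir]]] := near_optimal_path eta0.
have /choice[k0 k0P] : forall i, exists k, (k <= m)%N /\ edistance (a i) (q k) <= eta.
  by move=> i; have [k km ak] := qS _ (S_a i); exists k.
pose k i := if i is 0%N then 0%N else if (i <= n)%N then k0 i else m.
have kn1 : k n.+1 = m by rewrite /k ltnn.
have km i : (k i <= m)%N.
  by case: i => //= i; case: ifP => // _; case: (k0P i.+1).
have kv i : edistance (vertex n i) (q (k i)) <= eta.
  rewrite /vertex /k; case: i => [|i]; first by rewrite q0 edistancexx ltW.
  by case: ifP => _; [case: (k0P i.+1)|rewrite qm edistancexx ltW].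
have kmono i : (i < n.+1)%N -> (k i <= k i.+1)%N.
  (* A visit to [a i.+1] before [a i] would force a backward move. *)
  move=> iN; rewrite leqNgt; apply/negP => ki.
  have iltn : (i < n)%N.
    rewrite ltnNge; apply/negP => ni.
    have ein : i = n by apply/eqP; rewrite eqn_leq ni -ltnS iN.
    by move: ki; rewrite ein kn1 ltnNge km.
  have := qdir (k i.+1) (k i); rewrite (ltnW ki) km => /(_ isT).
  have := kv i; have := kv i.+1; rewrite /vertex (ltnW iltn) iltn => h1 h0.
  have d1 := edistance_triangle (q (k i)) (a i) (a i.+1).
  have d2 := edistance_triangle (q (k i.+1)) (q (k i)) (a i.+1).
  rewrite (edistance_edge ch) in d1.
  rewrite (edistanceC (q (k i.+1)) (a i.+1)) (edistanceC (q (k i)) (q (k i.+1))) in d2.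
  have u1 : enorm (u 0%N) = 1 by apply: enorm_eq; rewrite ?expr1n ?(chain_unit ch).
  have e0 := dot_geN (u 0%N) (a i - q (k i)).
  have e1 := dot_le (u 0%N) (a i.+1 - q (k i.+1)).
  have e2 : dot (u 0%N) (a i.+1) = dot (u 0%N) (a i) + l i * dot (u 0%N) (u i).
    by rewrite (chain_aS ch) dotDr dotZr.
  rewrite u1 -/(edistance (a i) (q (k i))) in e0.
  rewrite u1 -/(edistance (a i.+1) (q (k i.+1))) in e1.
  have ui := first_edge_dot ch i.
  have li := edge_nonincreasing ch (ltnW iltn).
  have : 3 / 4 * l i <= l i * dot (u 0%N) (u i) by rewrite mulrC ler_wpM2l// ltW// (edge_gt0 ch).
  move: e0 e1; rewrite !dotDr !dotNr e2; lra.
have [ks ksm sk] := qS _ Ss.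
have [|//|j jn /andP[js sj]] := @monotone_index_locate k n ks.
- by [].
- by rewrite kn1.
exists j => //.
pose exc := edistance (vertex n j) s + edistance s (vertex n j.+1)
    - edistance (vertex n j) (vertex n j.+1).
pose F i := edistance (vertex n i) (vertex n i.+1) - 4 * eta
  + (if i == j then exc else 0).
have FE i : (i < n.+1)%N -> F i <= \sum_(k i <= t < k i.+1) edistance (q t) (q t.+1).
  move=> iN; rewrite /F.
  have hi := kv i; have hi1 := kv i.+1.
  case: eqP => [->|_].
    rewrite (big_cat_nat js sj)/=.
    have p1 := path_length_ge q js; have p2 := path_length_ge q sj.
    have := edistance_triangle (q (k j)) (vertex n j) s.
    have := edistance_triangle (q ks) (q (k j)) s.
    have := edistance_triangle (q ks) s (vertex n j.+1).
    have := edistance_triangle (q (k j.+1)) (q ks) (vertex n j.+1).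
    rewrite (edistanceC (q ks) s) (edistanceC (q (k j.+1)) (vertex n j.+1)).
    have := kv j; have := kv j.+1; rewrite /exc; lra.
  have p1 := path_length_ge q (kmono _ iN).
  have := edistance_triangle (q (k i)) (vertex n i) (vertex n i.+1).
  have := edistance_triangle (q (k i.+1)) (q (k i)) (vertex n i.+1).
  rewrite (edistanceC (q (k i.+1)) (vertex n i.+1)); lra.
have [_] := sum_monotone_index kmono FE.
rewrite kn1 -/(path_length q m) => total.
have FS : \sum_(i < n.+1) F i = \sum_(i < n.+1) edistance (vertex n i) (vertex n i.+1)
    - n.+1%:R * (4 * eta) + exc.
  rewrite /F big_split/= sumrB sumr_const card_ord; congr (_ - _ + _).
    by rewrite [RHS]mulr_natl.
  have jn' : (j < n.+1)%N by [].
  rewrite (bigD1 (Ordinal jn'))//= eqxx big1 ?addr0// => i ij.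
  by case: eqP => // e; case/eqP: ij; exact: val_inj.
have := vertex_sum n; move: etaE; rewrite -[n.+2%:R]natr1 => etaE.
have : 0 <= n.+1%:R :> K by rewrite ler0n.
move: total; rewrite FS /exc; set N := n.+1%:R in etaE *; nra.
Qed.

Lemma minimizer_sub_chain : S `<=` Sigma.
Proof.
move=> s Ss; apply: closed_edistance.
  by apply: compact_closed_plane; exact: chain_set_compact ch.
move=> e e0; have l0 := edge_gt0 ch 0.
have m0 : 0 < Num.min (e / 4) (e ^+ 2 / (64 * l 0%N)).
  by rewrite lt_min !divr_gt0 ?exprn_gt0 ?mulr_gt0.
have [n] := edge_small ch m0; rewrite le_min => /andP[ln1 ln2].
have {}ln2 : 64 * l 0%N * l n <= e ^+ 2 by rewrite mulrC -ler_pdivlMr ?mulr_gt0.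
have ln0 := edge_gt0 ch n.
have lnl0 := edge_nonincreasing ch (leq0n n).
have [j jn /segment_near_of_excess[p pj sp]] := between_vertices n Ss.
have D3 : edistance (vertex n j) (vertex n j.+1) <= 3 * l 0%N.
  rewrite /vertex jn; case: ifP => [_|jn'].
    by rewrite (edistance_edge ch); have := edge_nonincreasing ch (leq0n j); lra.
  have -> : j = n by apply/eqP; rewrite eqn_leq jn leqNgt jn'.
  have := edistance_triangle a_oo (a n) a_oo1; rewrite (edistance_last ch).
  have := chain_a_lim ch n; lra.
have sp2 : edistance s p <= e / 2.
  have e2 : 0 <= e / 2 by rewrite divr_ge0// ltW.
  rewrite le_enorm// -enorm_sqr; apply: le_trans sp _.
  have h1 := ler_wpM2l (ltW ln0) D3.
  have h2 := ler_wpM2l (ltW ln0) lnl0.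
  have -> : (e / 2) ^+ 2 = e ^+ 2 / 4 by field.
  nra.
have [p' Sp' pp'] : exists2 p', Sigma p' & edistance p' p <= 2 * l n.
  move: pj; rewrite /vertex jn; case: ifP => [_ pj|jn' [t /= /andP[t0 t1] <-]].
    exists p; first by left; exists j.
    by rewrite edistancexx; lra.
  have ejn : j = n by apply/eqP; rewrite eqn_leq jn leqNgt jn'.
  exists ((1 - t) *: a_oo + t *: a_oo1); first by right; exists t => //=; rewrite t0.
  rewrite /edistance opprD addrACA subrr addr0 -scalerBr enormZ ejn.
  have := chain_a_lim ch n; rewrite edistanceC /edistance => h.
  by apply: le_trans h; rewrite ger0_norm ?subr_ge0// ler_piMl ?enorm_ge0// gerBl.
exists p' => //; have := edistance_triangle p p' s; rewrite (edistanceC p s); lra.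
Qed.

(** The image of the connected set [S] under [dot (u 0)] is an interval that
    contains the image of the chain, on which this form is injective. *)
Lemma minimizer_eq_chain : S = Sigma.
Proof.
apply/seteqP; split; first exact: minimizer_sub_chain.
move=> p Sp.
have first_p : dot (u 0%N) (a 0%N) <= dot (u 0%N) p.
  have b : before u (a 0%N) p.
    case: Sp => [[i _ /(before_edge_start ch)]|/(before_oo ch)].
      exact: before_trans (before_a ch (leq0n i)).
    exact: before_trans (before_a_oo ch 0).
  by move: b; rewrite /before dotDr dotNr; have := enorm_ge0 (p - a 0%N); lra.
have p_last : dot (u 0%N) p <= dot (u 0%N) a_oo1.
  have b : before u p a_oo1.
    case: Sp => [[i _ /(before_edge_end ch) pi]|].
      apply: before_trans pi _; apply: before_trans (before_a_oo ch _) _.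
      by apply: (before_oo ch); exact: segment_right.
    move=> [t /= /andP[t0 t1] <-].
    have e : a_oo1 = ((1 - t) *: a_oo + t *: a_oo1) + ((1 - t) * l 0%N) *: u_oo.
      by apply/rowP => i; rewrite !mxE; ring.
    rewrite [X in before _ _ X]e.
    apply: before_ray; rewrite ?(chain_unit_oo ch) ?(first_edge_dot_oo ch)//.
    by rewrite mulr_ge0 ?subr_ge0// ltW// (edge_gt0 ch).
  by move: b; rewrite /before dotDr dotNr; have := enorm_ge0 (a_oo1 - p); lra.
have /connected_intervalP fS : connected ((fun x => dot (u 0%N) x) @` S).
  apply: connected_continuous_connected => //.
  by apply: continuous_subspaceT; exact: dot_continuous.
have [] := fS (dot (u 0%N) (a 0%N)) (dot (u 0%N) a_oo1) _ _ (dot (u 0%N) p).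
- by exists (a 0%N).
- by exists a_oo1.
- by rewrite first_p.
move=> s Ss /(chain_set_inj ch (minimizer_sub_chain Ss) Sp) sp.
by rewrite -sp.
Qed.

End Uniqueness.

(** * Angles and the spiral on the circle *)

Section Angles.
Context {K : realType}.
Implicit Types (p q x u w : 'rV[K]_2).

Lemma cos_ratio_bounds p q x : 0 < edistance p q -> 0 < edistance x q ->
  -1 <= dot (p - q) (x - q) / (edistance p q * edistance x q) <= 1.
Proof.
move=> p0 x0; have d0 := mulr_gt0 p0 x0.
rewrite ler_pdivlMr// ler_pdivrMr// mulN1r mul1r.
by rewrite dot_geN dot_le.
Qed.

Lemma obtuse_dot_lt0 p q x : 0 < edistance p q -> 0 < edistance x q ->
  pi / 2 < angle p q x -> dot (p - q) (x - q) < 0.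
Proof.
move=> p0 x0; have bd := cos_ratio_bounds p0 x0; rewrite /angle.
set t := _ / _ in bd * => h.
have [t0 tpi] : 0 <= acos t /\ acos t <= pi by rewrite acos_ge0// acos_lepi.
have ct : cos (acos t) = t by apply: acosK; rewrite in_itv.
have : cos (acos t) < cos (pi / 2).
  have pi0 := pi_gt0 K.
  by rewrite ltr_cos// in_itv/= ?t0 ?tpi//; apply/andP; split; lra.
rewrite ct cos_pihalf /t pmulr_llt0// invr_gt0 mulr_gt0//.
Qed.

Lemma angle_eq_cos p p' q x : 0 < edistance p q -> 0 < edistance p' q ->
  0 < edistance x q -> angle p q x = angle p' q x ->
  dot (p - q) (x - q) / edistance p q = dot (p' - q) (x - q) / edistance p' q.
Proof.
move=> p0 p'0 x0; have bd := cos_ratio_bounds p0 x0.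
have bd' := cos_ratio_bounds p'0 x0; rewrite /angle => /(congr1 cos).
rewrite !acosK ?in_itv// !invfM !mulrA => /mulIf; apply.
by rewrite invr_neq0// gt_eqF.
Qed.

Definition cross u w : K := u 0 0 * w 0 1 - u 0 1 * w 0 0.

(** The inner product computed in the orthogonal frame of [p] and its rotation
    by a right angle. *)
Lemma dot_mul_frame u w p :
  dot u w * dot p p = dot u p * dot w p + cross u p * cross w p.
Proof. by rewrite !dotE /cross; ring. Qed.

Lemma crossBl u w p : cross (u - w) p = cross u p - cross w p.
Proof. by rewrite /cross !mxE; ring. Qed.

End Angles.

Section SpiralOnCircle.
Variables (K : realType) (R : K) (o : 'rV[K]_2).
Variables (a : nat -> 'rV[K]_2) (a_oo a_oo1 : 'rV[K]_2).
Variables (l : nat -> K) (u p : nat -> 'rV[K]_2) (u_oo : 'rV[K]_2).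
Hypothesis edge_length : forall i, edistance (a i) (a i.+1) = l i.
Hypothesis spiral_step : forall i, a i.+1 = a i + l i *: u i.
Hypothesis pE : forall i, p i = a i - o.
Hypothesis R_gt0 : 0 < R.
Hypothesis a_circle : forall i, circle o R (a i).
Hypothesis l0_gt0 : 0 < l 0%N.
Hypothesis l0_small : 20 * l 0%N <= R.
Hypothesis l_half : forall i, l i.+1 = 2^-1 * l i.
Hypothesis acute : forall i, 0 < dot (u i) (u i.+1).

Let lS i : l i.+1 = l i / 2.
Proof. by rewrite l_half mulrC. Qed.

Let l_pos i : 0 < l i.
Proof. by elim: i => // i IH; rewrite lS divr_gt0. Qed.

Let l_le i j : (i <= j)%N -> l j <= l i.
Proof.
move=> ij; rewrite -(subnKC ij); elim: (j - i)%N => [|n IH]; first by rewrite addn0.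
by rewrite addnS; apply: le_trans IH; rewrite lS; have := l_pos (i + n); lra.
Qed.

Lemma spiral_unit i : dot (u i) (u i) = 1.
Proof.
have := edge_length i; rewrite edistanceC /edistance spiral_step addrC addKr.
move=> /(congr1 (fun t => t ^+ 2)); rewrite enorm_sqr dotZl dotZr mulrA -expr2.
by move=> /(congr1 (fun t => t / l i ^+ 2)); rewrite mulrAC divff ?mul1r// gt_eqF// exprn_gt0.
Qed.

Let enorm_u i : enorm (u i) = 1.
Proof. by apply: enorm_eq; rewrite ?expr1n ?spiral_unit. Qed.

Let p_sqr i : dot (p i) (p i) = R ^+ 2.
Proof. by rewrite -enorm_sqr pE -(a_circle i). Qed.

Let enorm_p i : enorm (p i) = R.
Proof. by rewrite pE -(a_circle i). Qed.

Let pS i : p i.+1 = p i + l i *: u i.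
Proof. by rewrite !pE spiral_step addrAC. Qed.

Lemma chord_dot_start i : dot (u i) (p i) = - (l i / 2).
Proof.
have := p_sqr i.+1; rewrite pS !dot_lin (dotC (p i) (u i)) p_sqr spiral_unit => h.
have li := l_pos i.
have : l i * (2 * dot (u i) (p i) + l i) = 0 by lra.
by move=> /eqP; rewrite mulf_eq0 gt_eqF//= => /eqP; lra.
Qed.

Lemma chord_dot_end i : dot (u i) (p i.+1) = l i / 2.
Proof. by rewrite pS dotDr dotZr chord_dot_start spiral_unit; lra. Qed.

Lemma kink_normal i : dot (kink u i) (p i.+1) = 3 / 4 * l i.
Proof. by rewrite /kink dotDl dotNl chord_dot_end chord_dot_start lS; lra. Qed.

(** The tangential components of two consecutive unit directions have the same
    sign because the angle is obtuse. Their squares are known from the radial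
    components, and the difference of the squares is of second order in [l i]. *)
Lemma kink_tangential i : cross (kink u i) (p i.+1) ^+ 2 <= (l i ^+ 2 / (4 * R)) ^+ 2.
Proof.
rewrite /kink crossBl; set x := cross (u i) _; set y := cross (u i.+1) _.
have li := l_pos i; have liR : 20 * l i <= R.
  by apply: le_trans l0_small; rewrite ler_wpM2l// l_le.
have ex : x ^+ 2 = R ^+ 2 - l i ^+ 2 / 4.
  have := dot_mul_frame (u i) (u i) (p i.+1).
  by rewrite spiral_unit p_sqr chord_dot_end -/x; lra.
have ey : y ^+ 2 = R ^+ 2 - l i ^+ 2 / 16.
  have := dot_mul_frame (u i.+1) (u i.+1) (p i.+1).
  by rewrite spiral_unit p_sqr chord_dot_start -/y lS; lra.
have exy : 0 < x * y.
  have := dot_mul_frame (u i) (u i.+1) (p i.+1).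
  rewrite p_sqr chord_dot_end chord_dot_start -/x -/y => h.
  have := mulr_gt0 (acute i) (exprn_gt0 2 R_gt0); rewrite h.
  have := mulr_gt0 (l_pos i) (l_pos i.+1); lra.
have sum_sqr : R ^+ 2 <= (x + y) ^+ 2 by nra.
have R2 : 0 < R ^+ 2 by rewrite exprn_gt0.
have e : ((x - y) * (x + y)) ^+ 2 = (3 / 16 * l i ^+ 2) ^+ 2.
  have -> : (x - y) * (x + y) = x ^+ 2 - y ^+ 2 by ring.
  by rewrite ex ey; field.
rewrite exprMn in e.
have : (x - y) ^+ 2 * R ^+ 2 <= (l i ^+ 2 / 4) ^+ 2.
  apply: (@le_trans _ _ ((x - y) ^+ 2 * (x + y) ^+ 2)).
    by rewrite ler_wpM2l ?sqr_ge0.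
  by rewrite e; have := sqr_ge0 (l i ^+ 2); lra.
rewrite -ler_pdivlMr// => /le_trans; apply.
by rewrite le_eqVlt; apply/orP; left; apply/eqP; field; rewrite gt_eqF.
Qed.

Let radial i : 'rV[K]_2 := (3 * l i / (4 * R ^+ 2)) *: p i.+1.

Lemma kink_radial i : enorm (kink u i - radial i) <= l i ^+ 2 / (4 * R ^+ 2).
Proof.
have li := l_pos i; have Rn : R != 0 by rewrite gt_eqF.
have R2 : 0 < R ^+ 2 by rewrite exprn_gt0.
rewrite le_enorm; last by rewrite divr_ge0 ?exprn_ge0 ?mulr_ge0// ?exprn_ge0 ltW.
have := dot_mul_frame (kink u i - radial i) (kink u i - radial i) (p i.+1).
have -> : dot (kink u i - radial i) (p i.+1) = 0.
  by rewrite /radial dotDl dotNl dotZl kink_normal p_sqr; field.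
have -> : cross (kink u i - radial i) (p i.+1) = cross (kink u i) (p i.+1).
  by rewrite crossBl /radial /cross !mxE; ring.
rewrite p_sqr mul0r add0r -expr2 => e.
rewrite -(ler_pM2r R2) e; apply: le_trans (kink_tangential i) _.
by rewrite le_eqVlt; apply/orP; left; apply/eqP; field.
Qed.

Let enorm_radial i : enorm (radial i) = 3 * l i / (4 * R).
Proof.
have li := l_pos i; have Rn : R != 0 by rewrite gt_eqF.
rewrite /radial enormZ enorm_p ger0_norm; first by field.
by rewrite divr_ge0 ?mulr_ge0// ?exprn_ge0 ltW.
Qed.

Let correction_small i : l i ^+ 2 / (4 * R ^+ 2) <= 60^-1 * (3 * l i / (4 * R)).
Proof.
have li := l_pos i; have Rn : R != 0 by rewrite gt_eqF.
have liR : 20 * l i <= R.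
  by apply: le_trans l0_small; rewrite ler_wpM2l// l_le.
have -> : 60^-1 * (3 * l i / (4 * R)) = (l i * R / 20) / (4 * R ^+ 2) by field.
rewrite ler_pM2r ?invr_gt0 ?mulr_gt0 ?exprn_gt0//; nra.
Qed.

Lemma spiral_dist i j : (i <= j)%N -> edistance (a i) (a j) <= 2 * l i.
Proof.
move=> ij; suff h n : edistance (a i) (a (i + n)%N) <= 2 * l i - 2 * l (i + n)%N.
  by have := h (j - i)%N; rewrite (subnKC ij); have := l_pos j; lra.
elim: n => [|n IH]; first by rewrite addn0 edistancexx subrr.
rewrite addnS; apply: le_trans (edistance_triangle (a (i + n)%N) _ _) _.
rewrite edge_length; have := lS (i + n); lra.
Qed.

(** Every kink is a radial vector up to a relative error [1/60], and the radial
    directions at the different vertices are close to each other. *)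
Lemma spiral_kink_dot i j : 0 <= dot (kink u i) (kink u j).
Proof.
have Rn : R != 0 by rewrite gt_eqF.
have R2 : 0 < R ^+ 2 by rewrite exprn_gt0.
have pp : (9 / 10) * R ^+ 2 <= dot (p i.+1) (p j.+1).
  have d0 : edistance (a i.+1) (a j.+1) <= 2 * l 0%N.
    wlog ij : i j / (i <= j)%N.
      by move=> h; have [/h//|/ltnW/h] := leqP i j; rewrite edistanceC.
    apply: le_trans (spiral_dist (i := i.+1) (j := j.+1) ij) _.
    by rewrite ler_wpM2l// l_le.
  have := dot_le (p i.+1) (p i.+1 - p j.+1).
  have -> : p i.+1 - p j.+1 = a i.+1 - a j.+1 by rewrite !pE opprB addrA subrK.
  rewrite enorm_p -/(edistance _ _).
  have -> : a i.+1 - a j.+1 = p i.+1 - p j.+1 by rewrite !pE opprB addrA subrK.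
  rewrite dotDr dotNr p_sqr.
  have : R * edistance (a i.+1) (a j.+1) <= R * (R / 10).
    by rewrite ler_wpM2l ?(ltW R_gt0)//; move: l0_small; lra.
  lra.
have ei := kink_radial i; have ej := kink_radial j.
have ci := correction_small i; have cj := correction_small j.
have ri := enorm_radial i; have rj := enorm_radial j.
set si := 3 * l i / (4 * R) in ci ri; set sj := 3 * l j / (4 * R) in cj rj.
have si0 : 0 <= si by rewrite -ri enorm_ge0.
have sj0 : 0 <= sj by rewrite -rj enorm_ge0.
have rr : (9 / 10) * (si * sj) <= dot (radial i) (radial j).
  have -> : dot (radial i) (radial j) = (si * sj / R ^+ 2) * dot (p i.+1) (p j.+1).
    by rewrite /radial dotZl dotZr /si /sj; field.
  have c0 : 0 <= si * sj / R ^+ 2 by apply: divr_ge0; [exact: mulr_ge0|exact: ltW].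
  have := ler_wpM2l c0 pp.
  have -> : si * sj / R ^+ 2 * (9 / 10 * R ^+ 2) = 9 / 10 * (si * sj) by field.
  by [].
have -> : kink u i = radial i + (kink u i - radial i) by rewrite addrC subrK.
have -> : kink u j = radial j + (kink u j - radial j) by rewrite addrC subrK.
move: ei ej; set e := kink u i - _; set f := kink u j - _ => ei ej.
have ei' := le_trans ei ci; have ej' := le_trans ej cj.
have h1 := dot_geN (radial i) f; have h2 := dot_geN e (radial j).
have h3 := dot_geN e f.
rewrite ri in h1; rewrite rj in h2.
have k1 := ler_wpM2l si0 ej'; have k2 := ler_wpM2r sj0 ei'.
have k3 := ler_pM (enorm_ge0 e) (enorm_ge0 f) ei' ej'.
rewrite dotDl 2!dotDr; have := mulr_ge0 si0 sj0; lra.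
Qed.

Lemma spiral_kink_norm i : enorm (kink u i) <= l i / R.
Proof.
have -> : kink u i = radial i + (kink u i - radial i) by rewrite addrC subrK.
apply: le_trans (enormD _ _) _; rewrite enorm_radial.
have := le_trans (kink_radial i) (correction_small i).
have -> : 3 * l i / (4 * R) = 3 / 4 * (l i / R) by field; rewrite gt_eqF.
have : 0 <= l i / R by rewrite divr_ge0 ?ltW.
lra.
Qed.

Let turn10 n : \sum_(i < n) enorm (kink u i) <= 10^-1.
Proof.
apply: (@le_trans _ _ (\sum_(i < n) l i / R)).
  by apply: ler_sum => i _; exact: spiral_kink_norm.
rewrite -mulr_suml ler_pdivrMr//.
have sl : \sum_(i < n) l i = 2 * l 0%N - 2 * l n.
  elim: n => [|n IH]; first by rewrite big_ord0 subrr.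
  by rewrite big_ord_recr/= IH lS; lra.
by rewrite sl; have := l_pos n; move: l0_small; lra.
Qed.

Hypothesis a_cvg : a @ \oo --> a_oo.
Hypothesis tangent : tangent_line o a_oo a_oo1.
Hypothesis last_length : edistance a_oo a_oo1 = l 0%N.
Hypothesis forward : forall i, 0 < dot (a_oo1 - a_oo) (a_oo - a i).
Hypothesis lastE : a_oo1 = a_oo + l 0%N *: u_oo.

Lemma spiral_lim n : edistance (a n) a_oo <= 2 * l n.
Proof.
rewrite edistanceC; apply: (edistance_lim_le (n := n) a_cvg) => i ni.
by rewrite edistanceC spiral_dist.
Qed.

Lemma spiral_unit_oo : dot u_oo u_oo = 1.
Proof.
have := last_length; rewrite edistanceC /edistance lastE addrC addKr.
move=> /(congr1 (fun t => t ^+ 2)); rewrite enorm_sqr dotZl dotZr mulrA -expr2.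
by move=> /(congr1 (fun t => t / l 0%N ^+ 2)); rewrite mulrAC divff ?mul1r// gt_eqF// exprn_gt0.
Qed.

Let u_oo_tangent : dot u_oo (a_oo - o) = 0.
Proof.
have := tangent; rewrite /tangent_line/= lastE addrC addKr dotZl => /eqP.
by rewrite mulf_eq0 gt_eqF//= => /eqP.
Qed.

(** Otherwise all later edges would make an obtuse angle with [u_oo], as the
    total turn is small, and the chain would recede from [a_oo]. *)
Lemma spiral_u_oo_sign n : - 4^-1 < dot u_oo (u n).
Proof.
rewrite ltNge; apply/negP => h.
have uk k : (n <= k)%N -> dot u_oo (u k) <= 0.
  move=> nk.
  have e : u n - u k = \sum_(n <= i < k) kink u i.
    rewrite -(subnKC nk); elim: (k - n)%N => [|m IH].
      by rewrite addn0 subrr big_geq.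
    by rewrite addnS big_nat_recr ?leq_addr//= -IH /kink addrA subrK.
  have : enorm (u n - u k) <= 10^-1.
    rewrite e; apply: le_trans (enorm_sum _ _ _) _; apply: le_trans (turn10 k).
    rewrite -(big_mkord xpredT (fun i => enorm (kink u i))) (big_cat_nat (leq0n n) nk)/=.
    by rewrite lerDr sumr_ge0// => i _; exact: enorm_ge0.
  have := dot_geN u_oo (u n - u k).
  have -> : enorm u_oo = 1 by apply: enorm_eq; rewrite ?expr1n ?spiral_unit_oo.
  rewrite dotDr dotNr; lra.
have ak k : (n <= k)%N -> dot u_oo (a k) <= dot u_oo (a n).
  move=> nk; rewrite -(subnKC nk); elim: (k - n)%N => [|m IH]; first by rewrite addn0.
  rewrite addnS spiral_step dotDr dotZr.
  have := uk (n + m)%N (leq_addr _ _); have := l_pos (n + m); nra.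
have lim : dot u_oo a_oo <= dot u_oo (a n).
  have cv : (fun k => dot u_oo (a k)) @ \oo --> dot u_oo a_oo.
    apply: (@continuous_cvg _ _ _ _ _ _ (fun x => dot u_oo x)) => //.
    exact: dot_continuous.
  by apply: (cvgr_to_le cv); exists n.
have := forward n; have -> : a_oo1 - a_oo = l 0%N *: u_oo.
  by rewrite lastE addrC addKr.
rewrite dotZl pmulr_rgt0// dotDr dotNr; lra.
Qed.

(** The edge [u n] is almost orthogonal to the radius at [a_oo], so it is close
    to [u_oo] or to [- u_oo], and [spiral_u_oo_sign] decides which. *)
Lemma spiral_u_lim n : enorm (u n - u_oo) <= 4 / R * l n.
Proof.
have ln := l_pos n; have Rn : R != 0 by rewrite gt_eqF.
have R2 : 0 < R ^+ 2 by rewrite exprn_gt0.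
have lnR : 20 * l n <= R by apply: le_trans l0_small; rewrite ler_wpM2l// l_le.
pose q := a_oo - o.
have qR : dot q q = R ^+ 2.
  rewrite -enorm_sqr; congr (_ ^+ 2); apply/eqP; rewrite eq_le.
  apply/andP; split.
    by apply: (edistance_lim_le (n := 0%N) a_cvg) => i _; rewrite (a_circle i).
  have cv := edistance_cvg (y := o) a_cvg.
  by apply: (cvgr_to_ge cv); apply: nearW => i; rewrite (a_circle i).
set d := dot (u n) q.
have d_bd : d ^+ 2 <= 25 / 4 * l n ^+ 2.
  have e : d = dot (u n) (p n) + dot (u n) (a_oo - a n).
    by rewrite -dotDr /d /q pE; congr (dot _ _); rewrite [RHS]addrC subrKA.
  have dn : edistance a_oo (a n) <= 2 * l n by rewrite edistanceC spiral_lim.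
  have h1 := dot_le (u n) (a_oo - a n); have h2 := dot_geN (u n) (a_oo - a n).
  move: e h1 h2; rewrite enorm_u -/(edistance _ _) chord_dot_start => e h1 h2.
  nra.
set g := dot (u n) u_oo.
have g_sqr : g ^+ 2 * R ^+ 2 = R ^+ 2 - d ^+ 2.
  have e1 := dot_mul_frame (u n) u_oo q.
  have e2 := dot_mul_frame (u n) (u n) q.
  have e3 := dot_mul_frame u_oo u_oo q.
  move: e1 e2 e3; rewrite qR u_oo_tangent spiral_unit spiral_unit_oo -/g -/d.
  rewrite !mul1r !mulr0 !add0r -!expr2 => e1 e2 e3.
  have : (g ^+ 2 * R ^+ 2 - (R ^+ 2 - d ^+ 2)) * R ^+ 2 = 0.
    transitivity ((g * R ^+ 2) ^+ 2 - (R ^+ 2 - d ^+ 2) * R ^+ 2); first by ring.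
    by rewrite e1 {2}e3 e2; ring.
  by move=> /eqP; rewrite mulf_eq0 (gt_eqF R2) orbF subr_eq0 => /eqP.
have gs := spiral_u_oo_sign n; rewrite dotC -/g in gs.
have d_small : d ^+ 2 <= R ^+ 2 / 64 by nra.
have g1 : g <= 1.
  have := dot_le (u n) u_oo; rewrite enorm_u.
  have -> : enorm u_oo = 1 by apply: enorm_eq; rewrite ?expr1n ?spiral_unit_oo.
  by rewrite mulr1.
have g2 : 63 / 64 <= g ^+ 2.
  by rewrite -(ler_pM2r R2) g_sqr; lra.
have g0 : 0 < g by nra.
have gg : g ^+ 2 <= g by rewrite expr2 ler_piMl// ltW.
rewrite le_enorm; last by rewrite mulr_ge0 ?divr_ge0// ltW.
have -> : dot (u n - u_oo) (u n - u_oo) = 2 - 2 * g.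
  rewrite dotDl !dotDr !dotNl !dotNr (dotC u_oo) spiral_unit spiral_unit_oo /g.
  by ring.
rewrite -(ler_pM2r R2).
have -> : (4 / R * l n) ^+ 2 * R ^+ 2 = 16 * l n ^+ 2 by field.
have : (1 - g) * R ^+ 2 <= (1 - g ^+ 2) * R ^+ 2.
  by rewrite ler_wpM2r ?(ltW R2)// lerD2l lerN2.
have -> : (1 - g ^+ 2) * R ^+ 2 = d ^+ 2 by rewrite mulrBl g_sqr; ring.
have := sqr_ge0 (l n); lra.
Qed.

Lemma spiral_is_chain : is_chain a u l a_oo u_oo (4 / R).
Proof.
split => //.
- exact: spiral_unit.
- exact: spiral_kink_dot.
- by move=> n; apply: le_trans (turn10 n) _; lra.
- exact: spiral_unit_oo.
- by rewrite divr_ge0// ltW.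
- exact: spiral_u_lim.
- exact: spiral_lim.
Qed.

Lemma spiral_kink_neq0 i : 0 < dot (kink u i) (kink u i).
Proof.
rewrite lt_neqAle dot_ge0 andbT eq_sym; apply/eqP => /dot_eq0 k0.
by have := kink_normal i; rewrite k0 dot0l; have := l_pos i; lra.
Qed.

End SpiralOnCircle.

(** * Minimality among the admissible sets *)

Section Covering.
Context {K : realType}.
Implicit Types (x y v : 'rV[K]_2) (M S : set 'rV[K]_2) (r c : K).

Lemma covers_point r M S y : compact S -> covers r M S -> M y ->
  exists2 x, S x & edistance y x <= r.
Proof.
move=> Sk SM My.
have yS : (dist_to_set y S <= r%:E)%E.
  by apply: le_trans SM; apply: ereal_sup_ubound; exists y.
have S0 : S !=set0.
  apply/set0P/negP => /eqP S0; move: yS.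
  by rewrite /dist_to_set S0 image_set0 ereal_inf0.
have [|x Sx xmin] := compact_EVT_min S0 Sk (f := fun x => edistance x y).
  by apply: continuous_subspaceT; exact: edistance_continuous.
exists x; first by move: Sx; rewrite inE.
rewrite edistanceC -lee_fin; apply: le_trans yS.
apply: le_ereal_inf_tmp => _ [z Sz <-]; rewrite lee_fin (edistanceC y).
by apply: xmin; rewrite inE.
Qed.

Lemma covers_of_points r M S :
  (forall y, M y -> exists2 x, S x & edistance y x <= r) -> covers r M S.
Proof.
move=> h; apply: ge_ereal_sup => _ [y /h[x Sx yx] <-].
apply: (@le_trans _ _ (edistance y x)%:E); last by rewrite lee_fin.
by apply: ereal_inf_lbound; exists x.
Qed.

(** Strict convexity of the disc: the half-plane bounded by the tangent at [p]
    contains it and its boundary touches it only at [p]. *)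
Lemma ball_halfplane v p x w c r : edistance v p = r -> v - p = c *: w -> 0 < c ->
  edistance v x <= r ->
  0 <= dot w (x - p) /\ (dot w (x - p) <= 0 -> x = p).
Proof.
move=> vp vE c0 vx.
have key : dot (x - p) (x - p) <= 2 * c * dot w (x - p).
  have : edistance v x ^+ 2 <= edistance v p ^+ 2.
    by rewrite ler_pXn2r ?nnegrE ?edistance_ge0// vp.
  rewrite !enorm_sqr; have -> : v - x = (v - p) - (x - p) by rewrite opprB addrA subrK.
  rewrite vE; move: (x - p) => d.
  rewrite dotDl !dotDr !dotNl !dotNr !dotZl !dotZr (dotC d w); lra.
have d0 := dot_ge0 (x - p); split; first by nra.
move=> w0; apply/eqP; rewrite -subr_eq0; apply/eqP/dot_eq0; nra.
Qed.

End Covering.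

Section Minimality.
Variables (K : realType) (a u : nat -> 'rV[K]_2) (l : nat -> K).
Variables (a_oo u_oo : 'rV[K]_2) (C r : K).
Hypothesis ch : is_chain a u l a_oo u_oo C.
Variables (v : nat -> 'rV[K]_2) (v_oo v_oo1 : 'rV[K]_2).
Hypothesis r_gt0 : 0 < r.

Local Notation a_oo1 := (a_oo + l 0%N *: u_oo).
Local Notation Sigma := (chain_set a l a_oo u_oo).
Local Notation M := (range v `|` [set v_oo; v_oo1]).

Hypothesis v_dist : forall i, edistance (v i) (a i) = r.
Hypothesis v0E : v 0%N - a 0%N = r *: - u 0%N.
Hypothesis v_kink : forall i, exists2 c, 0 < c & v i.+1 - a i.+1 = c *: kink u i.
Hypothesis v_oo_dist : edistance v_oo a_oo = r.
Hypothesis v_oo1E : v_oo1 - a_oo1 = r *: u_oo.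

Let v_oo1_dist : edistance v_oo1 a_oo1 = r.
Proof.
rewrite /edistance v_oo1E enormZ ger0_norm ?ltW//.
by rewrite (@enorm_eq _ _ 1) ?mulr1// expr1n (chain_unit_oo ch).
Qed.

(** The points in which [S] meets the balls serve as terminals. Equality forces
    each of them onto the line through the corresponding vertex of Sigma. *)
Lemma admissible_length (S : set 'rV[K]_2) (H : K) : admissible r M S ->
  (hausdorff1 S <= H%:E)%E ->
  3 * l 0%N <= H /\ (H <= 3 * l 0%N -> (forall i, S (a i)) /\ S a_oo1).
Proof.
move=> [Sc Sk SM] SH.
have /choice[x xP] : forall i, exists x, S x /\ edistance (v i) x <= r.
  move=> i; have [|x Sx vx] := covers_point (y := v i) Sk SM.
    by left; exists i.
  by exists x.
have [|z Sz vz] := covers_point (y := v_oo1) Sk SM; first by right; right.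
have [h0 e0] := ball_halfplane (v_dist 0) v0E r_gt0 (xP 0%N).2.
have hk i : 0 <= dot (kink u i) (x i.+1 - a i.+1) /\
    (dot (kink u i) (x i.+1 - a i.+1) <= 0 -> x i.+1 = a i.+1).
  have [c c0 vE] := v_kink i.
  exact: ball_halfplane (v_dist i.+1) vE c0 (xP i.+1).2.
have [hz ez] := ball_halfplane v_oo1_dist v_oo1E r_gt0 vz.
rewrite dotNl in h0 e0.
have lb := chain_lower_bound ch Sc Sk SH (xP 0%N).1 Sz (xs := fun i => x i.+1)
  (fun i => (xP i.+1).1).
have {}lb n : 3 * l 0%N + dot u_oo (z - a_oo1) - dot (u 0%N) (x 0%N - a 0%N)
    + \sum_(i < n) dot (kink u i) (x i.+1 - a i.+1) <= H.
  apply: lb => //; first by rewrite -oppr_ge0.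
  by move=> i; case: (hk i).
have lb0 := lb 0%N; rewrite big_ord0 in lb0.
split; first by lra.
move=> H3; split; last by have <- : z = a_oo1 by apply: ez; lra.
case=> [|i].
  have <- : x 0%N = a 0%N by apply: e0; lra.
  by case: (xP 0%N).
case: (hk i) => hi ei; suff <- : x i.+1 = a i.+1 by case: (xP i.+1).
apply: ei; have := lb i.+1; rewrite big_ord_recr/=.
have : 0 <= \sum_(j < i) dot (kink u j) (x j.+1 - a j.+1).
  by apply: sumr_ge0 => j _; case: (hk j).
lra.
Qed.

Lemma Sigma_admissible : admissible r M Sigma.
Proof.
split; [exact: chain_set_connected ch|exact: chain_set_compact ch|].
apply: covers_of_points => y [[i _ <-]|[->|->]].
- exists (a i); last by rewrite v_dist.
  by left; exists i => //; exact: segment_left.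
- exists a_oo; last by rewrite v_oo_dist.
  by right; exact: segment_left.
- exists a_oo1; last by rewrite v_oo1_dist.
  by right; exact: segment_right.
Qed.

Lemma Sigma_minimizer : r_minimizer r M Sigma.
Proof.
split; first exact: Sigma_admissible.
move=> S Sadm; apply: le_trans (chain_set_hausdorff ch) _.
case e : (hausdorff1 S) => [H| |]; first last.
- have := (admissible_length (H := 0) Sadm); rewrite e leNye => /(_ isT)[l_le0 _].
  by exfalso; have := edge_gt0 ch 0; clear e; lra.
- by rewrite leey.
rewrite lee_fin; have := (admissible_length (H := H) Sadm).
by rewrite e => /(_ (lexx _))[].
Qed.

Lemma minimizer_unique S : r_minimizer r M S -> S = Sigma.
Proof.
move=> [Sadm Smin].
have SH := le_trans (Smin _ Sigma_admissible) (chain_set_hausdorff ch).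
have [_ /(_ (lexx _))[Sa Send]] := admissible_length Sadm SH.
by case: Sadm => Sc Sk _; exact: (minimizer_eq_chain ch Sc Sk SH Sa Send).
Qed.

End Minimality.

(** * The configuration of the theorem *)

Section TerminalPositions.
Context {K : realType}.
Implicit Types (u w x : 'rV[K]_2).

(** The ray starts only [L < r] behind [a0], so its point at distance [r] from
    [a0] lies beyond [a0]. *)
Lemma ray_step (a0 w x : 'rV[K]_2) (r L : K) : dot w w = 1 -> 0 < L < r ->
  ray (a0 - L *: w) a0 x -> edistance x a0 = r -> x - a0 = r *: w.
Proof.
move=> w1 /andP[L0 Lr] [t /= t0 <-].
have -> : a0 - L *: w + t *: (a0 - (a0 - L *: w)) = a0 + ((t - 1) * L) *: w.
  by apply/rowP => i; rewrite !mxE; ring.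
rewrite /edistance addrC addKr enormZ (@enorm_eq _ w 1) ?expr1n// mulr1 => e.
congr (_ *: _); move: e; case: (ger0P ((t - 1) * L)) => // _ e.
have := mulr_ge0 t0 (ltW L0); lra.
Qed.


(** Both vectors are orthogonal to the bisector [u + w]. *)
Lemma bisector_parallel u w x : dot u u = 1 -> dot w w = 1 -> 0 < dot u w ->
  0 < dot (u - w) (u - w) -> - dot u x = dot w x -> dot w x < 0 ->
  exists2 c, 0 < c & x = c *: (u - w).
Proof.
move=> u1 w1 uw k0 ux wx.
exists (dot x (u - w) / dot (u - w) (u - w)).
  rewrite divr_gt0// dotDr dotNr (dotC x u) (dotC x w); lra.
apply: (@orthogonal_parallel _ (u + w)).
- by rewrite gt_eqF// dotDl !dotDr u1 w1 (dotC w u); lra.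
- by rewrite gt_eqF.
- by rewrite dotDl -ux subrr.
- by rewrite dotDl !dotDr !dotNr u1 w1 (dotC w u); ring.
Qed.

End TerminalPositions.

(* The sequences are indexed from 0: [a i] and [v i] are the points usually
   numbered i + 1. *)
Theorem theorem2p17 (K : realType) (r R : K) (o : 'rV[K]_2) :
  0 < r -> 0 < R ->
  exists N0 : nat, forall N : nat, (N0 <= N)%N ->
  forall (a : nat -> 'rV[K]_2) (a_oo a_oo1 : 'rV[K]_2)
         (v : nat -> 'rV[K]_2) (v_oo v_oo1 : 'rV[K]_2),
  (forall i, circle o R (a i)) ->
  N%:R * edistance (a 0%N) (a 1%N) = r ->
  (forall i, edistance (a i.+1) (a i.+2) = 2^-1 * edistance (a i) (a i.+1)) ->
  (forall i, pi / 2 < angle (a i) (a i.+1) (a i.+2)) ->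
  a @ \oo --> a_oo ->
  tangent_line o a_oo a_oo1 ->
  edistance a_oo a_oo1 = r / N%:R ->
  (forall i, 0 < dot (a_oo1 - a_oo) (a_oo - a i)) ->
  ray (a 1%N) (a 0%N) (v 0%N) ->
  edistance (v 0%N) (a 0%N) = r ->
  (forall i, edistance (v i.+1) (a i.+1) = r) ->
  (forall i, angle (a i) (a i.+1) (v i.+1) = angle (a i.+2) (a i.+1) (v i.+1)) ->
  (forall i, pi / 2 < angle (a i.+2) (a i.+1) (v i.+1)) ->
  v @ \oo --> v_oo ->
  ray a_oo a_oo1 v_oo1 ->
  segment a_oo v_oo1 a_oo1 ->
  edistance v_oo1 a_oo1 = r ->
  let Sigma := (\bigcup_i segment (a i) (a i.+1)) `|` segment a_oo a_oo1 in
  let M := range v `|` [set v_oo; v_oo1] in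
  [/\ dot (v_oo1 - a_oo) (v_oo - a_oo) = 0,
      compact M,
      r_minimizer r M Sigma &
      forall S : set 'rV[K]_2, r_minimizer r M S -> S = Sigma].
Proof.
(* This bound makes the first edge at most [R / 20] and shorter than [r]. *)
move=> r0 R0; exists (Num.bound (20 * r / R)).+2 => N N_ge a a_oo a_oo1 v v_oo v_oo1.
move=> a_circle Nr l_half a_obtuse a_cvg tangent last_len forward.
move=> v0_ray v0_dist v_dist v_bisect v_obtuse v_cvg v_oo1_ray _ v_oo1_dist Sigma M.
have N2 : 2 <= N%:R :> K by rewrite ler_nat; apply: leq_trans N_ge.
have NR : 20 * r <= N%:R * R.
  rewrite -ler_pdivrMr//; apply: le_trans (_ : (Num.bound (20 * r / R))%:R <= _).
    by apply: ltW; apply: archi_boundP; rewrite divr_ge0 ?mulr_ge0// ltW.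
  by rewrite ler_nat; apply: leq_trans N_ge; rewrite leqW// leqW.
have [l lE] : exists l : nat -> K, forall i, edistance (a i) (a i.+1) = l i by eexists.
have lS i : l i.+1 = 2^-1 * l i by rewrite -!lE.
rewrite lE in Nr.
have l0 : 0 < l 0%N by rewrite -(pmulr_rgt0 _ (lt_le_trans (ltr0n K 2 : 0 < 2) N2)) Nr.
have l_pos i : 0 < l i by elim: i => // i IH; rewrite lS mulr_gt0// invr_gt0.
have l0R : 20 * l 0%N <= R.
  have N0 : 0 < N%:R :> K by lra.
  by rewrite -(ler_pM2l N0) mulrCA Nr.
have l0r : 0 < l 0%N < r by rewrite l0/= -Nr; nra.
have {}last_len : edistance a_oo a_oo1 = l 0%N.
  by rewrite last_len -Nr mulrC mulKf// gt_eqF//; lra.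
have [u uE] : exists u : nat -> 'rV[K]_2, forall i, a i.+1 = a i + l i *: u i.
  exists (fun i => (l i)^-1 *: (a i.+1 - a i)) => i.
  by rewrite scalerA divff ?gt_eqF// scale1r addrC subrK.
have [u_oo u_ooE] : exists u_oo : 'rV[K]_2, a_oo1 = a_oo + l 0%N *: u_oo.
  exists ((l 0%N)^-1 *: (a_oo1 - a_oo)).
  by rewrite scalerA divff ?gt_eqF// scale1r addrC subrK.
have u1 := spiral_unit lE uE l0 lS.
have back i : a i - a i.+1 = - (l i *: u i) by rewrite uE opprD addrA subrr add0r.
have front i : a i.+2 - a i.+1 = l i.+1 *: u i.+1 by rewrite uE addrC addKr.
have back_len i : 0 < edistance (a i) (a i.+1) by rewrite lE.
have front_len i : 0 < edistance (a i.+2) (a i.+1) by rewrite edistanceC lE.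
have acute i : 0 < dot (u i) (u i.+1).
  have := obtuse_dot_lt0 (back_len i) (front_len i) (a_obtuse i).
  by rewrite back front dotNl dotZl dotZr oppr_lt0 !pmulr_rgt0.
have ch := spiral_is_chain (p := fun i => a i - o) lE uE (fun i => erefl) R0 a_circle
  l0 l0R lS acute a_cvg tangent last_len forward u_ooE.
have kink_gt0 := spiral_kink_neq0 (p := fun i => a i - o) lE uE (fun i => erefl) a_circle l0 lS.
have v_balance i : - dot (u i) (v i.+1 - a i.+1) = dot (u i.+1) (v i.+1 - a i.+1).
  have v_len : 0 < edistance (v i.+1) (a i.+1) by rewrite v_dist.
  have := angle_eq_cos (back_len i) (front_len i) v_len (v_bisect i).
  rewrite back front dotNl !dotZl [edistance (a i.+2) _]edistanceC !lE mulNr.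
  by rewrite !(mulrC (l _)) !mulfK ?gt_eqF.
have v_outward i : dot (u i.+1) (v i.+1 - a i.+1) < 0.
  have v_len : 0 < edistance (v i.+1) (a i.+1) by rewrite v_dist.
  have := obtuse_dot_lt0 (front_len i) v_len (v_obtuse i).
  by rewrite front dotZl pmulr_rlt0.
have v_kink i : exists2 c, 0 < c & v i.+1 - a i.+1 = c *: kink u i.
  exact: bisector_parallel (u1 i) (u1 i.+1) (acute i) (kink_gt0 i) (v_balance i)
    (v_outward i).
have v0E : v 0%N - a 0%N = r *: - u 0%N.
  apply: (ray_step (L := l 0%N)) l0r _ v0_dist; first by rewrite dotNl dotNr opprK.
  by rewrite scalerN opprK -uE.
have v_oo1E : v_oo1 - a_oo1 = r *: u_oo.
  apply: (ray_step (L := l 0%N)) (chain_unit_oo ch) l0r _ v_oo1_dist.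
  by rewrite {1}u_ooE addrK.
have near_oo e : 0 < e -> exists i, [/\ edistance (v i.+1) v_oo <= e,
    edistance (a i.+1) a_oo <= e, enorm (u i - u_oo) <= e &
    enorm (u i.+1 - u_oo) <= e].
  move=> e0; have [n1 vn1] := edistance_cvg0 v_cvg e0.
  have m0 : 0 < Num.min (e / 2) (e * R / 4).
    by rewrite lt_min !divr_gt0// mulr_gt0.
  have [n2] := edge_small ch m0; rewrite le_min => /andP[ln2 ln2'].
  pose i := maxn n1 n2.
  have li := edge_nonincreasing ch (leq_maxr n1 n2); rewrite -/i in li.
  have li1 := edge_nonincreasing ch (leqnSn i).
  have Rl k : l k <= l i -> 4 / R * l k <= e.
    by move=> lk; rewrite mulrAC ler_pdivrMr//; lra.
  exists i; split.
  - by apply: vn1; apply: leqW; exact: leq_maxl.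
  - by apply: le_trans (chain_a_lim ch i.+1) _; lra.
  - by apply: le_trans (chain_u_lim ch i) _; exact: Rl.
  - by apply: le_trans (chain_u_lim ch i.+1) _; exact: Rl.
have v_oo_dist : edistance v_oo a_oo = r.
  apply/eqP; rewrite eq_le; apply/andP; split; apply/ler_addgt0Pr => e e0;
    have [|i [vi ai _ _]] := near_oo (e / 2); rewrite ?divr_gt0//;
    have := v_dist i.
    have := edistance_triangle (v i.+1) v_oo a_oo.
    have := edistance_triangle (a i.+1) (v i.+1) a_oo.
    by rewrite (edistanceC v_oo (v i.+1)); lra.
  have := edistance_triangle v_oo (v i.+1) (a i.+1).
  have := edistance_triangle a_oo v_oo (a i.+1).
  by rewrite (edistanceC a_oo (a i.+1)); lra.
have v_oo_orth : dot u_oo (v_oo - a_oo) = 0.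
  have u_oo_norm : enorm u_oo = 1.
    by apply: enorm_eq; rewrite ?expr1n ?(chain_unit_oo ch).
  have bound e : 0 < e -> `|dot u_oo (v_oo - a_oo)| <= (r + 2) * e.
    move=> e0; have [i [vi ai ui ui1]] := near_oo e e0.
    (* [v i.+1 - a i.+1] is orthogonal to [u i + u i.+1], which tends to
       [2 *: u_oo]. *)
    have split : 2 * dot u_oo (v_oo - a_oo) =
        - dot (u i - u_oo) (v_oo - a_oo) - dot (u i.+1 - u_oo) (v_oo - a_oo)
        - dot (u i) ((v i.+1 - v_oo) - (a i.+1 - a_oo))
        - dot (u i.+1) ((v i.+1 - v_oo) - (a i.+1 - a_oo)).
      have := v_balance i; rewrite !dot_lin; lra.
    have V_norm : enorm (v_oo - a_oo) = r := v_oo_dist.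
    have W_norm : enorm ((v i.+1 - v_oo) - (a i.+1 - a_oo)) <= 2 * e.
      by apply: le_trans (enormB _ _) _; move: vi ai; rewrite /edistance; lra.
    have u_norm k : enorm (u k) = 1 by apply: enorm_eq; rewrite ?expr1n.
    have r_ge0 := ltW r0.
    have h1 := ler_wpM2r r_ge0 ui; have h2 := ler_wpM2r r_ge0 ui1.
    have d1 := dot_le (u i - u_oo) (v_oo - a_oo).
    have d1' := dot_geN (u i - u_oo) (v_oo - a_oo).
    have d2 := dot_le (u i.+1 - u_oo) (v_oo - a_oo).
    have d2' := dot_geN (u i.+1 - u_oo) (v_oo - a_oo).
    have d3 := dot_le (u i) ((v i.+1 - v_oo) - (a i.+1 - a_oo)).
    have d3' := dot_geN (u i) ((v i.+1 - v_oo) - (a i.+1 - a_oo)).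
    have d4 := dot_le (u i.+1) ((v i.+1 - v_oo) - (a i.+1 - a_oo)).
    have d4' := dot_geN (u i.+1) ((v i.+1 - v_oo) - (a i.+1 - a_oo)).
    rewrite V_norm in d1 d1' d2 d2'; rewrite !u_norm in d3 d3' d4 d4'.
    by rewrite ler_norml; apply/andP; split; lra.
  apply/eqP; rewrite -normr_le0; apply/ler_addgt0Pr => e e0; rewrite add0r.
  have r2 : 0 < r + 2 by lra.
  by have := bound _ (divr_gt0 e0 r2); rewrite mulrC divfK// gt_eqF.
have v_all i : edistance (v i) (a i) = r by case: i.
have SigmaE : Sigma = chain_set a l a_oo u_oo by rewrite /Sigma u_ooE.
rewrite u_ooE in v_oo1E.
split.
- have -> : v_oo1 - a_oo = (r + l 0%N) *: u_oo.
    by rewrite scalerDl -v_oo1E opprD addrA subrK.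
  by rewrite dotZl v_oo_orth mulr0.
- have -> : M = \bigcup_i [set v i] `|` [set v_oo; v_oo1].
    congr (_ `|` _); apply/seteqP; split => [_ [i _ <-]|x [i _ ->]]; by exists i.
  apply: (compact_bigcup_cvg (p := v_oo)).
  + by move=> i; exact: compact_set1.
  + by apply: compactU; exact: compact_set1.
  + by left.
  + move=> W /v_cvg[n _ vn]; exists n => i /vn vW _ ->; exact: vW.
- by rewrite SigmaE; exact: (Sigma_minimizer ch r0 v_all v0E v_kink v_oo_dist v_oo1E).
- move=> S; rewrite SigmaE.
  exact: (minimizer_unique ch r0 v_all v0E v_kink v_oo_dist v_oo1E).
Qed.
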